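(* Let $k\ge3$ and let $(q_m)_{m\ge1}$ be an increasing sequence of prime powers, $q_m=p_m^{e_m}$. For each $m$ let $S(k,q_m)=S(k,q_m;f_{3,m},g_{3,m},\ldots,f_{k,m},g_{k,m})$ with $g_{i,m}(0)=0$ for all $i$, and suppose $d_f^{(m)}\ge1$ and $1\le d_g^{(m)}<p_m$ for all $m$. Let $\lambda^{(m)}$ be the largest eigenvalue of $S(k,q_m)$ that is different from $q_m(q_m-1)$. Then for every $m$, $\lambda^{(m)}\le d_f^{(m)}q_m+d_g^{(m)}q_m^{3/2}$; in particular $\lambda^{(m)}=\max\bigl(O(d_f^{(m)}q_m),\,O(d_g^{(m)}q_m^{3/2})\bigr)$.
   Context: For a prime power $q$, $k\ge3$, and $f_i,g_i\in\mathbb{F}_q[X]$ ($3\le i\le k$) of degree at most $q-1$ with $g_i(-X)=-g_i(X)$, $S(k,q;f_3,g_3,\ldots,f_k,g_k)$ is the simple graph on vertex set $\mathbb{F}_q^k$ in which $a$ and $b$ are adjacent iff $a_1\ne b_1$ and $b_i-a_i=g_i(b_1-a_1)f_i\!\left(\frac{b_2-a_2}{b_1-a_1}\right)$ for $3\le i\le k$; it is $q(q-1)$-regular. $d_f^{(m)}=\max_{3\le i\le k}\deg f_{i,m}$ and $d_g^{(m)}=\max_{3\le i\le k}\deg g_{i,m}$. Eigenvalues are those of the adjacency matrix. *)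

(* Defs.v *)
From HB Require Import structures.
From mathcomp Require Import all_boot all_order all_algebra all_field.
Set Implicit Arguments. Unset Strict Implicit. Unset Printing Implicit Defensive.
Import Order.TTheory GRing.Theory Num.Theory.
Local Open Scope ring_scope.

(* Convention: the paper's coordinates 1..k are the indices 0..k-1 of 'I_k;
   the paper's index i (3 <= i <= k) is the ordinal i-1 (2 <= i-1 < k). *)

Definition vertex (F : finFieldType) (k : nat) := {ffun 'I_k -> F}.

(* the n-th coordinate (0-based) of a vertex; 0 if n >= k (never used for k >= 3, n <= 1) *)
Definition coord (F : finFieldType) (k : nat) (a : vertex F k) (n : nat) : F :=
  if @insub _ (fun m => m < k)%N 'I_k n is Some i then a i else 0.

Definition S_adj (F : finFieldType) (k : nat) (f g : 'I_k -> {poly F})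
    (a b : vertex F k) : bool :=
  let x := coord b 0 - coord a 0 in
  let y := (coord b 1 - coord a 1) / x in
  (coord a 0 != coord b 0) &&
  [forall i : 'I_k, (2 <= i)%N ==> (b i - a i == (g i).[x] * (f i).[y])].

Definition S_adjmx (F : finFieldType) (k : nat) (f g : 'I_k -> {poly F}) :
    'M[algC]_(#|{: vertex F k}|) :=
  \matrix_(i, j) ((S_adj f g (enum_val i) (enum_val j))%:R : algC).

(* d_f = max_{3<=i<=k} deg f_i, d_g likewise (degree of 0 taken as 0) *)
Definition dmax (F : finFieldType) (k : nat) (h : 'I_k -> {poly F}) : nat :=
  \max_(i : 'I_k | (2 <= i)%N) (size (h i)).-1.

Definition S_params (F : finFieldType) (k : nat) (f g : 'I_k -> {poly F}) : Prop :=
  forall i : 'I_k, (2 <= i)%N ->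
    [/\ (size (f i) <= #|F|)%N, (size (g i) <= #|F|)%N
      & g i \Po (- 'X) = - g i].

(* Main.v *)
(* The graph is a Cayley graph of F_q^k, so its eigenvalues are the sums over x <> 0 and y of
   psi(G_y(x)), where psi is an additive character and G_y(x) = (w_1 + w_2 y) x + sum w_i f_i(y) g_i(x).
   The coefficients of G_y are polynomials of degree at most d_f in y: unless they all vanish (and the
   eigenvalue is q(q-1)), at most d_f values of y give G_y = 0, each contributing at most q.  For the
   others 1 <= deg G_y <= d_g < p, and the sum over x is at most d_g sqrt(q) by Weil's bound.

   Weil's bound for f of degree d prime to p: h |-> psi(sum of f over the roots of h) is multiplicative
   on monic polynomials, and its sum over the monic h of degree n vanishes for n >= d.  Hence the
   character sums S_n over the extensions of degree n are minus the n-th power sums of d - 1 numbers,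
   and it suffices to show S_n = O(q^(n/2)) for even n.  This follows from N <= Q + O(sqrt Q) for the
   number N of points of the curves y^p = y + f(x) - z over the field with Q = r^2 elements, proved by
   Stepanov's method in Bombieri's form: choose a nonzero G = sum of u_s s^r, with s running over a basis
   of a space of functions of small pole order, such that sum of u_s^r s = 0; then G^r vanishes at every
   rational point, and N is at most the pole order of G. *)

Require Import Defs.
From HB Require Import structures.
From mathcomp Require Import all_boot all_order all_algebra all_field.
From mathcomp Require Import zify ring.
Import Order.TTheory GRing.Theory Num.Theory.
Local Open Scope ring_scope.
Set Implicit Arguments. Unset Strict Implicit. Unset Printing Implicit Defensive.

(** * Growth of power sums of algebraic numbers *)

Lemma geometric_unbounded (x D : algC) (n0 : nat) :
  0 <= x -> (forall n, (n0 <= n)%N -> x ^+ n <= D) -> x <= 1.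
Proof.
move=> x0 xD; rewrite real_leNgt ?ger0_real ?ler01 //; apply/negP=> x1.
have D0 : 0 <= D by apply: le_trans (xD n0 _) => //; rewrite exprn_ge0.
pose e := x - 1; have e0 : 0 < e by rewrite subr_gt0.
have bern n : 1 + e *+ n <= x ^+ n.
  elim: n => [|n IHn]; first by rewrite mulr0n addr0 expr0.
  rewrite exprS; apply: le_trans (ler_wpM2l x0 IHn).
  have -> : x * (1 + e *+ n) = 1 + e *+ n.+1 + e * (e *+ n).
    by rewrite -[x](subrK 1) -/e mulrS; ring.
  by rewrite lerDl mulr_ge0 ?mulrn_wge0 // ltW.
pose m := Num.bound (D / e).
have /(_ (m + n0)%N) := xD; rewrite leq_addl => /(_ isT) Hm.
have := le_trans (bern (m + n0)%N) Hm; apply/negP.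
rewrite -real_ltNge ?ger0_real ?addr_ge0 ?mulrn_wge0 ?ler01 ?(ltW e0) //.
have : D / e < m%:R.
  by apply: archi_boundP; rewrite divr_ge0 // ltW.
rewrite ltr_pdivrMr // mulr_natl => Dm.
apply: lt_le_trans Dm _; apply: (@le_trans _ _ (e *+ (m + n0))).
  by rewrite mulrnDr lerDl mulrn_wge0 // ltW.
by rewrite lerDr ler01.
Qed.

(** Each [a] satisfies [|a|^n |P(a)| <= D B^n] for large [n], so the powers of [|a| / B] stay
    bounded. Repeated entries only multiply the contribution of [a] by a positive integer. *)
Lemma power_sum_growth (s : seq algC) (C B : algC) (n0 : nat) :
  0 < B -> (forall n, (n0 <= n)%N -> `|\sum_(a <- s) a ^+ n| <= C * B ^+ n) ->
  forall a, a \in s -> `|a| <= B.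
Proof.
move=> B0 sC a sa.
pose P : {poly algC} := \prod_(b <- rem a (undup s)) ('X - b%:P).
(* Weighting the shifted power sums by the coefficients of P isolates the contribution of a. *)
have Pa : P.[a] != 0.
  by rewrite -/(root P a) root_prod_XsubC mem_rem_uniqF ?undup_uniq.
have Pb b : b \in s -> b != a -> P.[b] = 0.
  move=> sb ba; apply/eqP; rewrite -/(root P b) root_prod_XsubC.
  by rewrite mem_rem_uniq ?undup_uniq // !inE ba mem_undup.
have key n : \sum_(l < size P) P`_l * (\sum_(b <- s) b ^+ (n + l)) =
    (a ^+ n * P.[a]) *+ count_mem a s.
  transitivity (\sum_(b <- s) b ^+ n * P.[b]).
    under eq_bigr do rewrite mulr_sumr.
    rewrite exchange_big /=; apply: eq_bigr => b _.
    rewrite horner_coef mulr_sumr; apply: eq_bigr => l _.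
    by rewrite exprD mulrCA.
  rewrite (bigID (pred1 a)) /= [X in _ + X]big1_seq => [|b /andP[ba sb]]; last first.
    by rewrite Pb // mulr0.
  rewrite addr0 (eq_bigr (fun=> a ^+ n * P.[a])) => [|b /eqP-> //].
  by rewrite big_const_seq iter_addr_0.
have sgt0 : (0 < count_mem a s)%N by rewrite -has_count has_pred1.
pose D := \sum_(l < size P) `|P`_l| * (C * B ^+ l).
have main n : (n0 <= n)%N -> `|a| ^+ n * `|P.[a]| <= D * B ^+ n.
  move=> n0n; rewrite -normrX -normrM.
  apply: (@le_trans _ _ `|(a ^+ n * P.[a]) *+ count_mem a s|).
    by rewrite normrMn -mulr_natr ler_peMr // ler1n.
  rewrite -key; apply: le_trans (ler_norm_sum _ _ _) _.
  rewrite mulr_suml; apply: ler_sum => l _; rewrite normrM -mulrA ler_wpM2l //.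
  rewrite -mulrA -exprD [(l + n)%N]addnC; apply: sC; exact: leq_trans n0n (leq_addr _ _).
rewrite -[B]mul1r -ler_pdivrMr //.
apply: (@geometric_unbounded _ (D / `|P.[a]|) n0); first by rewrite divr_ge0 // ltW.
move=> n n0n; rewrite expr_div_n ler_pdivrMr ?exprn_gt0 // mulrAC.
by rewrite ler_pdivlMr ?normr_gt0 // main.
Qed.

Lemma size_mul_le (R : nzSemiRingType) (A B : {poly R}) (a b c : nat) :
  (size A <= a)%N -> (size B <= b)%N -> ((a + b).-1 <= c)%N -> (size (A * B)%R <= c)%N.
Proof. by move=> sA sB; apply: leq_trans; apply: leq_trans (size_polyMleq _ _) _; lia. Qed.

(** * Sums over the roots of a polynomial *)

Section Residue.

Variable F : fieldType.
Implicit Types (f g h A B : {poly F}).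

Lemma coefM_top A B i j : (size A <= i.+1)%N -> (size B <= j.+1)%N ->
  (A * B)`_(i + j) = A`_i * B`_j.
Proof.
move=> sA sB; rewrite coefM.
have ilt : (i < (i + j).+1)%N by rewrite ltnS leq_addr.
rewrite (bigD1 (Ordinal ilt)) //= addKn big1 ?addr0 // => k ki.
have [kli|ilk|kEi] := ltngtP k i.
- by rewrite [B`__]nth_default ?mulr0 //; apply: leq_trans sB _; lia.
- by rewrite [A`__]nth_default ?mul0r //; apply: leq_trans sA _; lia.
- by case/eqP: ki; apply: val_inj.
Qed.

(* Coefficient of 1/X in the expansion at infinity of A / h, for h monic. *)
Definition residue h A := (A %% h)`_(size h).-2.

Lemma residueD h : {morph residue h : A B / A + B}.
Proof. by move=> A B; rewrite /residue modpD coefD. Qed.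

(** [A B / (h B)] and [A / h] are the same rational function, with the same expansion at
    infinity. *)
Lemma residueM h B A : h \is monic -> B \is monic ->
  residue (h * B) (A * B) = residue h A.
Proof.
move=> hm Bm; have h0 := monic_neq0 hm; have B0 := monic_neq0 Bm.
rewrite /residue {1}(divp_eq A h) mulrDl -mulrA modp_addl_mul_small; last first.
  have [->|R0] := eqVneq (A %% h) 0; first by rewrite mul0r size_poly0 size_poly_gt0 mulf_neq0.
  have := ltn_modpN0 A h0; rewrite !size_mul // => ltRh.
  have sB : (0 < size B)%N by rewrite size_poly_gt0.
  by rewrite -ltnS !prednK ?addn_gt0 ?sB ?orbT // ltn_add2r.
rewrite size_mul //; have sB : (0 < size B)%N by rewrite size_poly_gt0.
have sh : (0 < size h)%N by rewrite size_poly_gt0.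
have := ltn_modpN0 A h0; case Eh: (size h) sh => [|[|n]] // _ sR.
  move: sR; rewrite ltnS leqn0 size_poly_eq0 => /eqP->.
  by rewrite mul0r !coef0.
have -> : (n.+2 + size B).-1.-2 = (n + (size B).-1)%N by lia.
rewrite coefM_top //; last by rewrite prednK.
by rewrite -lead_coefE (eqP Bm) mulr1.
Qed.

(* The sum of the values of f at the roots of h (Euler's formula). *)
Definition root_sum f h := residue h (f * h^`()).

Lemma root_sumM f g h : g \is monic -> h \is monic ->
  root_sum f (g * h) = root_sum f g + root_sum f h.
Proof.
move=> gm hm; rewrite /root_sum derivM mulrDr residueD.
rewrite mulrA residueM //; have -> : f * (g * h^`()) = f * h^`() * g by ring.
by rewrite [g * h]mulrC residueM.
Qed.

Lemma root_sum1 f : root_sum f 1 = 0.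
Proof. by rewrite /root_sum /residue modp1 coef0. Qed.

Lemma root_sum_XsubC f c : root_sum f ('X - c%:P) = f.[c].
Proof.
by rewrite /root_sum /residue derivXsubC mulr1 modp_XsubC size_XsubC coefC.
Qed.

Lemma root_sum_prod f (s : seq F) :
  root_sum f (\prod_(c <- s) ('X - c%:P)) = \sum_(c <- s) f.[c].
Proof.
elim: s => [|c s IHs]; first by rewrite !big_nil root_sum1.
rewrite !big_cons root_sumM ?monicXsubC ?monic_prod_XsubC //.
by rewrite root_sum_XsubC IHs.
Qed.

(** With [u = c X^(n-d)], the logarithmic derivatives of [h + u] and [h] differ by
    [(u' h - h' u) / ((h + u) h)]. After multiplication by [f], only top coefficients reach the
    residue: [lead_coef f] times [c (n - d) - c n = - c d]. *)
Lemma root_sum_shift f h c (d n : nat) : size f = d.+1 -> h \is monic ->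
  size h = n.+1 -> (0 < d <= n)%N ->
  root_sum f (h + c *: 'X^(n - d)) = root_sum f h - (lead_coef f * c) *+ d.
Proof.
move=> sf hm sh /andP[d0 dn]; set h2 := h + _.
have sc : (size (c *: 'X^(n - d) : {poly F}) <= (n - d).+1)%N.
  by rewrite (leq_trans (size_scale_leq _ _)) // size_polyXn.
have scl : (size (c *: 'X^(n - d) : {poly F}) < size h)%N.
  by rewrite sh; apply: leq_ltn_trans sc _; lia.
have sh2 : size h2 = n.+1 by rewrite /h2 size_polyDl.
have h2m : h2 \is monic by rewrite monicE /h2 lead_coefDl.
set u : {poly F} := c *: _ in h2 scl sc sh2 h2m *.
have residue_split : root_sum f h2 = residue (h2 * h) (f * (u^`() * h - h^`() * u)) + root_sum f h.
  rewrite /root_sum -(residueM _ h2m hm) -(residueM _ hm h2m) [h * h2]mulrC -residueD.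
  by congr residue; rewrite /h2 derivD; ring.
rewrite residue_split addrC; congr (_ + _).
have u' : u^`() = (c *+ (n - d)) *: 'X^((n - d).-1).
  by rewrite /u derivZ derivXn -scalerMnr scalerMnl.
have su' : (size u^`() <= n - d)%N.
  rewrite u'; have [->|nd] := eqVneq (n - d)%N 0%N; first by rewrite mulr0n scale0r size_poly0.
  by rewrite (leq_trans (size_scale_leq _ _)) // size_polyXn prednK // lt0n.
have sh' : (size h^`() <= n)%N.
  by rewrite -ltnS -sh lt_size_deriv ?monic_neq0.
have sW : (size (u^`() * h - h^`() * u)%R <= (n + n - d.+1).+1)%N.
  rewrite (leq_trans (size_polyD _ _)) // geq_max size_polyN.
  apply/andP; split; last by apply: size_mul_le sh' sc _; lia.
  by apply: (size_mul_le su' (eq_leq sh)); lia.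
have sM : size (h2 * h) = (n + n).+1.
  by rewrite size_monicM ?monic_neq0 // sh2 sh addSn addnS.
rewrite /residue modp_small sM; last first.
  rewrite ltnS.
  by apply: (size_mul_le (eq_leq sf) sW); lia.
have -> : (n + n).+1.-2 = (d + (n + n - d.+1))%N by lia.
rewrite coefM_top ?sf // lead_coefE sf -mulrnAr -[RHS]mulrN; congr (_ * _).
rewrite coefB; have -> : (h^`() * u)`_(n + n - d.+1) = c *+ n.
  have -> : (n + n - d.+1)%N = (n.-1 + (n - d))%N by lia.
  rewrite coefM_top ?prednK //; try lia.
  rewrite coef_deriv prednK; last lia.
  have -> : h`_n = 1 by have := eqP hm; rewrite lead_coefE sh.
  by rewrite /u coefZ coefXn eqxx mulr1 mulr_natl.
have -> : (u^`() * h)`_(n + n - d.+1) = c *+ (n - d).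
  have [nd|nd] := eqVneq (n - d)%N 0%N.
    by rewrite u' nd mulr0n scale0r mul0r coef0.
  have -> : (n + n - d.+1)%N = ((n - d).-1 + n)%N by lia.
  rewrite coefM_top ?prednK ?sh ?lt0n //.
  have -> : h`_n = 1 by have := eqP hm; rewrite lead_coefE sh.
  by rewrite u' coefZ coefXn eqxx !mulr1.
by rewrite mulrnBr // addrAC subrr add0r.
Qed.

End Residue.

Lemma map_root_sum (F K : fieldType) (iota : {rmorphism F -> K}) (f h : {poly F}) :
  root_sum (map_poly iota f) (map_poly iota h) = iota (root_sum f h).
Proof.
by rewrite /root_sum /residue deriv_map -rmorphM /= -map_modp coef_map size_map_poly.
Qed.

(** * Monic and irreducible polynomials over a finite field *)

Section MonicCount.

Variable F : finFieldType.
Implicit Types (P Q h : {poly F}).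

(** A list, since polynomials do not form a finite type; a row vector holds the lower
    coefficients. *)
Definition monics n : seq {poly F} := [seq 'X^n + rVpoly v | v <- enum 'rV[F]_n].

Lemma mem_monics n h : (h \in monics n) = (h \is monic) && (size h == n.+1).
Proof.
apply/mapP/andP=> [[v _ ->]|[hm /eqP sh]].
  have sv : (size (rVpoly v) < n.+1)%N by rewrite ltnS size_poly.
  rewrite monicE lead_coefDl ?size_polyXn // lead_coefXn eqxx.
  by rewrite size_polyDl ?size_polyXn.
exists (poly_rV (take_poly n h)); first by rewrite mem_enum.
rewrite poly_rV_K ?size_take_poly // addrC -[LHS](poly_take_drop n); congr (_ + _).
suff -> : drop_poly n h = 1 by rewrite mul1r.
apply/polyP=> i; rewrite coef_drop_poly coef1; case: i => [|i].
  by rewrite add0n; have := eqP hm; rewrite lead_coefE sh.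
by rewrite nth_default // sh; lia.
Qed.

Lemma uniq_monics n : uniq (monics n).
Proof.
rewrite map_inj_uniq ?enum_uniq // => u v /addrI /(congr1 (poly_rV (d := n))).
by rewrite !rVpolyK.
Qed.

Lemma monics_monic n h : h \in monics n -> h \is monic.
Proof. by rewrite mem_monics => /andP[]. Qed.

Lemma size_monics n h : h \in monics n -> size h = n.+1.
Proof. by rewrite mem_monics => /andP[_ /eqP]. Qed.

(** A decidable test, so that [irreds] can be a filtered list: trial division by the monic
    polynomials of degree 1 to [deg P - 1]. *)
Definition irredb P :=
  (1 < size P)%N && all (fun r => all (fun Q => ~~ (Q %| P)) (monics r))
                        (iota 1 (size P).-2).

Lemma irredbP P : reflect (irreducible_poly P) (irredb P).
Proof.
apply: (iffP andP) => [[sP noQ]|[sP irrP]]; split=> //.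
  move=> Q sQ QP.
  have P0 : P != 0 by rewrite -size_poly_gt0 (ltn_trans _ sP).
  have Q0 : Q != 0 by apply: contraNneq P0 => Q0; rewrite Q0 dvd0p in QP.
  have sQ0 : (0 < size Q)%N by rewrite size_poly_gt0.
  rewrite -dvdp_size_eqp // eqn_leq dvdp_leq //= leqNgt; apply/negP=> sQP.
  have /allP/(_ (size Q).-1) := noQ.
  rewrite mem_iota; case Es: (size Q) sQ sQ0 sQP => [|[|n]] // _ _ nP.
  have {}nP : (n.+2 < size P)%N := nP.
  have -> : (1 <= n.+2.-1 < 1 + (size P).-2)%N by lia.
  move=> /(_ isT)/allP/(_ ((lead_coef Q)^-1 *: Q)).
  rewrite mem_monics monicE lead_coefZ mulVf ?lead_coef_eq0 // eqxx.
  rewrite size_scale ?invr_eq0 ?lead_coef_eq0 // Es eqxx dvdpZl ?invr_eq0 ?lead_coef_eq0 //.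
  by rewrite QP => /(_ isT).
apply/allP=> r; rewrite mem_iota => rP; apply/allP=> Q /size_monics sQ.
apply/negP=> QP; have r0 : (0 < r)%N by lia.
have := irrP Q; rewrite sQ eqSS -lt0n r0 => /(_ isT QP)/eqp_size; rewrite sQ => sPE.
by move: rP; rewrite -sPE; lia.
Qed.

Definition irreds r : seq {poly F} := [seq P <- monics r | irredb P].

Lemma mem_irreds r P : P \in irreds r ->
  [/\ P \is monic, size P = r.+1, (0 < r)%N & irreducible_poly P].
Proof.
rewrite mem_filter => /andP[/irredbP iP Pr].
rewrite (monics_monic Pr) (size_monics Pr); split=> //.
by have [] := iP; rewrite (size_monics Pr).
Qed.

Lemma irred_dvd_or_coprime P Q : irreducible_poly P -> (P %| Q) || coprimep P Q.
Proof.
move=> [sP iP]; rewrite /coprimep; have [//|/iP] := eqVneq (size (gcdp P Q)) 1%N; first by rewrite orbT.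
by move=> /(_ (dvdp_gcdl _ _)) /eqp_dvdl <-; rewrite dvdp_gcdr.
Qed.

Lemma irred_monic_eq P Q : irreducible_poly P -> irreducible_poly Q ->
  P \is monic -> Q \is monic -> P %| Q -> P = Q.
Proof.
move=> [sP _] [_ iQ] Pm Qm /iQ; rewrite gtn_eqF // => /(_ isT).
by rewrite eqp_monic // => /eqP.
Qed.

Lemma exists_irred_factor h : (1 < size h)%N ->
  exists P, [/\ irreducible_poly P, P \is monic & P %| h].
Proof.
have [n] := ubnP (size h); elim: n h => // n IHn h sh h1.
have h0 : h != 0 by rewrite -size_poly_gt0 (ltn_trans _ h1).
have [/irredbP hi|] := boolP (irredb h).
  exists ((lead_coef h)^-1 *: h); split.
  - have l0 : (lead_coef h)^-1 != 0 by rewrite invr_eq0 lead_coef_eq0.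
    split; first by rewrite size_scale.
    move=> q q1; rewrite dvdpZr // => /hi.2 -/(_ q1) /eqp_trans; apply.
    by rewrite eqp_sym eqp_scale.
  - by rewrite monicE lead_coefZ mulVf ?lead_coef_eq0.
  - by rewrite dvdpZl ?invr_eq0 ?lead_coef_eq0.
rewrite /irredb h1 /= => /allPn[r]; rewrite mem_iota => hr /allPn[Q Qr].
rewrite negbK => Qh; have sQ := size_monics Qr.
have {}hr : (1 <= r < 1 + (size h).-2)%N := hr.
have sQh : (size Q < size h)%N by rewrite sQ; lia.
have [| | P [iP Pm PQ]] := IHn Q; [exact: leq_trans sQh _ | by rewrite sQ; lia |].
by exists P; split=> //; apply: dvdp_trans PQ Qh.
Qed.

(* The analogue for monic polynomials of log n = sum of the von Mangoldt function over the divisors of n. *)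
Lemma degree_prime_powers N h : h \is monic -> (size h <= N)%N ->
  (\sum_(r < N) \sum_(P <- irreds r) \sum_(k < N) r * (P ^+ k.+1 %| h)%R)%N = (size h).-1.
Proof.
have [n] := ubnP (size h); elim: n h => // n IHn h sh hm hN.
have h0 := monic_neq0 hm; have sh0 : (0 < size h)%N by rewrite size_poly_gt0.
have [h1|h1] := leqP (size h) 1.
  have -> : (size h).-1 = 0%N by lia.
  rewrite big1 // => r _; rewrite big1_seq // => P /andP[_ /mem_irreds[Pm sP r0 _]].
  rewrite big1 // => k _; suff /negPf-> : ~~ (P ^+ k.+1 %| h) by rewrite muln0.
  apply/negP=> /(dvdp_trans (dvdp_exp2l P (ltn0Sn k))) /(dvdp_leq h0).
  by rewrite expr1 leqNgt sP ltnS (leq_trans h1).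
have [P [iP Pm Ph]] := exists_irred_factor h1.
have [h' Eh] : exists h' : {poly F}, h = h' * P by apply/dvdpP.
have h'm : h' \is monic by rewrite -(monicMr _ Pm) -Eh.
have h'0 := monic_neq0 h'm; have P0 := monic_neq0 Pm.
have sP : (1 < size P)%N by case: iP.
have shE : size h = (size h' + (size P).-1)%N.
  by rewrite Eh size_monicM //; case: (size P) sP => [|m] // _; rewrite addnS.
have sh'0 : (0 < size h')%N by rewrite size_poly_gt0.
have sh1 : (size h' < size h)%N by lia.
have shn : (size h' < n)%N := leq_trans sh1 sh.
have shN : (size h' <= N)%N := leq_trans (ltnW sh1) hN.
have deg_h : ((size h').-1 + (size P).-1)%N = (size h).-1 by lia.
have PrP : ((size P).-1 < N)%N by lia.
have Pin : P \in irreds (size P).-1.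
  by rewrite mem_filter mem_monics Pm prednK ?(ltnW sP) // eqxx !andbT; apply/irredbP.
(* Removing the factor [P] from [h] lowers the multiplicity of [P] by one and leaves those of the
   other irreducibles unchanged. *)
have step r Q : Q \in irreds r ->
    (\sum_(k < N) r * (Q ^+ k.+1 %| h)%R = \sum_(k < N) r * (Q ^+ k.+1 %| h')%R + r * (Q == P))%N.
  move=> /mem_irreds[Qm sQ r0 iQ]; have Q0 := monic_neq0 Qm.
  have [->|QP] := eqVneq Q P; last first.
    rewrite muln0 addn0; apply: eq_bigr => k _; rewrite Eh Gauss_dvdpl //.
    apply: coprimep_expl; have /orP[QdP|//] := irred_dvd_or_coprime P iQ.
    by case/eqP: QP; apply: irred_monic_eq.
  rewrite muln1 -!big_distrr /= -mulnSr; congr (_ * _)%N.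
  have -> : (\sum_(k < N) (P ^+ k.+1 %| h)%R = \sum_(k < N) (P ^+ k %| h')%R)%N.
    by apply: eq_bigr => k _; rewrite Eh exprSr dvdp_mul2r.
  have [M EM] : exists M, N = M.+1 by exists N.-1; rewrite prednK // (leq_ltn_trans _ PrP).
  have sh1M : (size h' <= M.+1)%N by rewrite -EM.
  rewrite EM big_ord_recl expr0 dvd1p [in RHS]big_ord_recr /=.
  suff /negPf-> : ~~ (P ^+ M.+1 %| h') by rewrite addn0 add1n.
  apply/negP=> /(dvdp_leq h'0); apply/negP; rewrite -ltnNge.
  have : (M.+1 < size (P ^+ M.+1)%R)%N.
    by rewrite -[X in (_ < X)%N]prednK ?size_poly_gt0 ?expf_neq0 // size_exp ltnS leq_pmull // -subn1 subn_gt0.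
  by apply: leq_ltn_trans; exact: sh1M.
transitivity (\sum_(r < N) \sum_(Q <- irreds r) (\sum_(k < N) r * (Q ^+ k.+1 %| h')%R + r * (Q == P)))%N.
  by apply: eq_bigr => r _; apply: eq_big_seq => Q /step.
under eq_bigr do rewrite big_split.
rewrite big_split /= IHn //.
rewrite (bigD1 (Ordinal PrP)) //= (bigD1_seq P) ?filter_uniq ?uniq_monics //= eqxx muln1.
rewrite [X in (_ + (_ + X + _))%N]big1_seq => [|Q /andP[/negPf-> _]]; last by rewrite muln0.
rewrite big1 => [|r rP]; first by rewrite !addn0.
rewrite big1_seq // => Q /andP[_ /mem_irreds[_ sQ _ _]].
have [QP|] := eqVneq Q P; last by rewrite muln0.
by case/eqP: rP; apply: val_inj; rewrite /= -QP sQ.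
Qed.

End MonicCount.

(** * Additive characters of a finite field *)

Definition add_char (G : zmodType) (psi : G -> algC) :=
  psi 0 = 1 /\ {morph psi : a b / a + b >-> a * b}.

Section AddChar.

Variables (F : finFieldType) (psi : F -> algC).
Hypothesis psiC : add_char psi.

Lemma add_charMn a k : psi (a *+ k) = psi a ^+ k.
Proof. by elim: k => [|k IHk]; rewrite ?psiC.1 // mulrS psiC.2 IHk exprS. Qed.

Lemma add_char_norm a : `|psi a| = 1.
Proof.
have [p p_pr pF] := finPcharP F.
have /eqP : `|psi a| ^+ p = 1.
  by rewrite -normrX -add_charMn mulrn_pchar // psiC.1 normr1.
by rewrite pexpr_eq1 ?prime_gt0 // => /eqP.
Qed.

Lemma add_charN a : psi (- a) = (psi a)^*.
Proof.
have E : psi (- a) * psi a = 1 by rewrite -psiC.2 addNr psiC.1.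
have pa0 : psi a != 0 by rewrite -normr_eq0 add_char_norm oner_eq0.
by apply: (mulIf pa0); rewrite E mulrC -normCK add_char_norm expr1n.
Qed.

Lemma add_char_sum : (exists t, psi t != 1) -> \sum_x psi x = 0.
Proof.
move=> [t t1]; have E : \sum_x psi x = psi t * \sum_x psi x.
  by rewrite mulr_sumr (reindex_inj (addrI t)); apply: eq_bigr => x _; rewrite psiC.2.
apply/eqP; move/eqP: E; rewrite -subr_eq0 -{1}[\sum_x _]mul1r -mulrBl mulf_eq0 subr_eq0 eq_sym.
by rewrite (negPf t1).
Qed.

End AddChar.

(** * The L-function of an additive character *)

Section LFunction.

Variables (F : finFieldType) (psi : F -> algC) (f : {poly F}).
Hypothesis psiC : add_char psi.
Implicit Types (P Q h : {poly F}).

(** Completely multiplicative on monic polynomials; it plays the part of a Dirichlet character, with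
    [Lcoef] as the coefficients of its L-function. *)
Definition char_poly_sum h := psi (root_sum f h).

Lemma char_poly_sumM P Q : P \is monic -> Q \is monic ->
  char_poly_sum (P * Q) = char_poly_sum P * char_poly_sum Q.
Proof. by move=> Pm Qm; rewrite /char_poly_sum root_sumM // psiC.2. Qed.

Lemma char_poly_sumXn P k : P \is monic ->
  char_poly_sum (P ^+ k) = char_poly_sum P ^+ k.
Proof.
move=> Pm; elim: k => [|k IHk]; last by rewrite !exprS char_poly_sumM ?monic_exp // IHk.
by rewrite !expr0 /char_poly_sum root_sum1 psiC.1.
Qed.

Definition Lcoef n := \sum_(h <- monics F n) char_poly_sum h.

Lemma Lcoef0 : Lcoef 0 = 1.
Proof.
have E : perm_eq (monics F 0) [:: 1].
  apply: uniq_perm; rewrite ?uniq_monics // => h.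
  rewrite mem_monics inE; apply/andP/eqP=> [[hm /eqP/eq_leq/size1_polyC Eh]|->].
    by move: hm; rewrite Eh monicE lead_coefC => /eqP->.
  by rewrite monic1 size_poly1.
by rewrite /Lcoef (perm_big _ E) big_seq1 /char_poly_sum root_sum1 psiC.1.
Qed.

Lemma sum_monics_multiple Q n m : Q \is monic -> size Q = m.+1 ->
  \sum_(h <- monics F n | Q %| h) char_poly_sum h =
  (char_poly_sum Q * Lcoef (n - m)) *+ (m <= n)%N.
Proof.
move=> Qm sQ; have Q0 := monic_neq0 Qm; have [mn|nm] := leqP m n; last first.
  rewrite big1_seq // => h /andP[/dvdp_leq-/(_ _)/= Qh /[dup] /monics_monic hm /size_monics sh].
  by have := Qh (monic_neq0 hm); rewrite sQ sh ltnS leqNgt nm.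
rewrite mulr1n -big_filter mulr_sumr.
have E : perm_eq [seq h <- monics F n | Q %| h] [seq Q * h | h <- monics F (n - m)].
  apply: uniq_perm; first by rewrite filter_uniq ?uniq_monics.
    by rewrite map_inj_uniq ?uniq_monics //; apply: mulfI.
  move=> h; rewrite mem_filter; apply/andP/mapP=> [[/dvdpP[h' ->] h'Q]|[h' h'n ->]].
    exists h'; last by rewrite mulrC.
    have h'm : h' \is monic by rewrite -(monicMr _ Qm) (monics_monic h'Q).
    have := size_monics h'Q; rewrite size_monicM ?monic_neq0 // sQ addnS /= => sh'.
    rewrite mem_monics h'm -(eqn_add2r m) sh'; apply/eqP; lia.
  rewrite dvdp_mulr // mem_monics (monicMl _ Qm) (monics_monic h'n).
  by rewrite size_monicM ?monic_neq0 ?(monics_monic h'n) // sQ (size_monics h'n); split=> //; lia.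
rewrite (perm_big _ E) big_map; apply: eq_big_seq => h /monics_monic hm.
by rewrite char_poly_sumM.
Qed.

(* Coefficients of T L'(T) / L(T), read off the Euler product of L(T) = sum of Lcoef n T^n. *)
Definition Lpower_sum j :=
  \sum_(r < j.+1) \sum_(P <- irreds F r | (r %| j)%N) (char_poly_sum P ^+ (j %/ r)) *+ r.

Lemma Lpower_sum_widen N j : (0 < j < N)%N -> Lpower_sum j =
  \sum_(r < N) \sum_(P <- irreds F r | (r %| j)%N) (char_poly_sum P ^+ (j %/ r)) *+ r.
Proof.
move=> /andP[j0 jN]; rewrite /Lpower_sum.
rewrite (big_ord_widen N (fun r => \sum_(P <- irreds F r | (r %| j)%N) (char_poly_sum P ^+ (j %/ r)) *+ r)) //.
rewrite big_mkcond; apply: eq_bigr => r _; case: ltnP => // jr.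
by rewrite big_pred0 // => P; apply/negbTE; apply: contraTN jr => /dvdn_leq-/(_ j0); rewrite -ltnNge.
Qed.

Lemma sum_multiples (G : nat -> algC) n r : (0 < r)%N ->
  \sum_(k < n.+1 | (r * k.+1 <= n)%N) G k.+1 = \sum_(j < n | (r %| j.+1)%N) G (j.+1 %/ r)%N.
Proof.
move=> r0; transitivity (\sum_(k < n.+1) \sum_(j < n | j.+1 == (r * k.+1)%N) G k.+1).
  rewrite big_mkcond; apply: eq_bigr => k _; case: leqP => kn.
    have k'n : ((r * k.+1).-1 < n)%N by rewrite prednK // muln_gt0 r0.
    rewrite (big_pred1 (Ordinal k'n)) // => j /=; rewrite -val_eqE /=.
    by rewrite -[RHS]eqSS prednK // muln_gt0 r0.
  by rewrite big_pred0 // => j; apply/negbTE; rewrite neq_ltn (leq_ltn_trans _ kn).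
under eq_bigr do rewrite big_mkcond.
rewrite exchange_big [RHS]big_mkcond /=; apply: eq_bigr => j _; rewrite -big_mkcond /=.
case: ifP => [/dvdnP[q Eq]|rj]; last first.
  rewrite big_pred0 // => k; apply/negbTE; apply: contraFN rj => /eqP->.
  exact: dvdn_mulr.
have q0 : (0 < q)%N by case: q Eq.
have qn : (q.-1 < n.+1)%N.
  rewrite prednK // ltnW // ltnS; apply: leq_trans (ltn_ord j); rewrite Eq.
  exact: leq_pmulr.
rewrite (big_pred1 (Ordinal qn)) => [|k /=]; first by rewrite /= prednK // Eq mulnK.
by rewrite -val_eqE /= Eq mulnC eqn_pmul2l // -[RHS]eqSS prednK // eq_sym.
Qed.

(** [T L'(T)] is [L(T)] times the series of the [Lpower_sum j]. Each [h] of degree [n] is counted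
    [n] times, [n] is written as the sum of [deg P] over the powers [P^k] dividing [h], and the [h]
    divisible by a given [P^k] are summed first. *)
Lemma Lcoef_newton n :
  Lcoef n *+ n = \sum_(j < n) Lpower_sum j.+1 * Lcoef (n - j.+1).
Proof.
transitivity (\sum_(r < n.+1) \sum_(P <- irreds F r) \sum_(k < n.+1)
    (char_poly_sum P ^+ k.+1 * Lcoef (n - r * k.+1)) *+ ((r * k.+1 <= n)%N * r)%N).
  transitivity (\sum_(h <- monics F n) \sum_(r < n.+1) \sum_(P <- irreds F r)
      \sum_(k < n.+1) char_poly_sum h *+ (r * (P ^+ k.+1 %| h)%R)).
    have -> : Lcoef n *+ n = \sum_(h <- monics F n) char_poly_sum h *+ n by rewrite sumrMnl.
    apply: eq_big_seq => h hn.
    have hm := monics_monic hn; have sh := size_monics hn.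
    rewrite -[X in _ *+ X]/(n.+1.-1) -sh -(@degree_prime_powers _ n.+1) ?sh //.
    rewrite -sumrMnr; apply: eq_bigr => r _; rewrite -sumrMnr; apply: eq_bigr => P _.
    by rewrite -sumrMnr.
  rewrite exchange_big /=; apply: eq_bigr => r _.
  rewrite exchange_big /=; apply: eq_big_seq => P /mem_irreds[Pm sP r0 iP].
  rewrite exchange_big /=; apply: eq_bigr => k _.
  have sPk : size (P ^+ k.+1) = (r * k.+1).+1.
    by rewrite -[LHS]prednK ?size_poly_gt0 ?expf_neq0 ?monic_neq0 // size_exp sP.
  rewrite mulrnA -char_poly_sumXn // -(sum_monics_multiple _ (monic_exp _ Pm) sPk).
  rewrite [in RHS]big_mkcond -sumrMnl; apply: eq_bigr => h _.
  by rewrite mulnC mulrnA; case: (_ %| _); rewrite ?mulr0n.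
transitivity (\sum_(j < n) \sum_(r < n.+1) \sum_(P <- irreds F r | (r %| j.+1)%N)
    (char_poly_sum P ^+ (j.+1 %/ r)) *+ r * Lcoef (n - j.+1)); last first.
  apply: eq_bigr => j _; rewrite (@Lpower_sum_widen n.+1) ?ltnS ?ltn_ord //.
  by rewrite mulr_suml; apply: eq_bigr => r _; rewrite mulr_suml.
rewrite [RHS]exchange_big; apply: eq_bigr => r _ /=.
under [RHS]eq_bigr do rewrite big_mkcond.
rewrite [RHS]exchange_big; apply: eq_big_seq => P /mem_irreds[_ _ r0 _] /=.
transitivity (\sum_(k < n.+1 | (r * k.+1 <= n)%N)
    (char_poly_sum P ^+ k.+1 * Lcoef (n - r * k.+1)) *+ r).
  rewrite [RHS]big_mkcond; apply: eq_bigr => k _.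
  by rewrite mulrnA; case: leqP => _; rewrite ?mulr0n ?mul0rn.
rewrite (sum_multiples (fun k => (char_poly_sum P ^+ k * Lcoef (n - r * k)) *+ r)) //.
rewrite big_mkcond; apply: eq_bigr => j _; case: ifP => // rj.
by rewrite mulrnAl mulnC divnK.
Qed.

Variable d : nat.
Hypotheses (psiN1 : exists t, psi t != 1) (sf : size f = d.+1).
Hypotheses (d_gt0 : (0 < d)%N) (dF : d%:R != 0 :> F).

(** Adding [c X^(n-d)] permutes the monic polynomials of degree [n] and multiplies every term by the
    same [psi t], which is not 1. *)
Lemma Lcoef_eq0 n : (d <= n)%N -> Lcoef n = 0.
Proof.
move=> dn; have [t psit] := psiN1.
have lf0 : lead_coef f != 0 by rewrite lead_coef_eq0 -size_poly_gt0 sf.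
(* Solves [- (lead_coef f * c) *+ d = t], the shift in [root_sum_shift]; here [d] must be invertible
   in [F]. *)
pose c := - t / (lead_coef f * d%:R).
pose u : {poly F} := c *: 'X^(n - d).
have su : (size u < n.+1)%N.
  by rewrite (leq_ltn_trans (size_scale_leq _ _)) // size_polyXn; lia.
have shift h : h \in monics F n ->
    h + u \in monics F n /\ char_poly_sum (h + u) = psi t * char_poly_sum h.
  move=> hn; have hm := monics_monic hn; have sh := size_monics hn.
  split; first by rewrite mem_monics monicE lead_coefDl ?sh // -monicE hm size_polyDl sh //=.
  rewrite /char_poly_sum (root_sum_shift _ sf hm sh) ?d_gt0 // psiC.2 mulrC.
  congr (_ * _); congr psi; rewrite -mulr_natr mulrAC /c mulrC -mulrA.
  by rewrite mulVf ?mulf_neq0 // mulr1 opprK.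
have perm_shift : perm_eq (monics F n) [seq h + u | h <- monics F n].
  have uS : uniq [seq h + u | h <- monics F n] by rewrite map_inj_uniq ?uniq_monics //; apply: addIr.
  have subS : {subset [seq h + u | h <- monics F n] <= monics F n}.
    by move=> _ /mapP[h /shift[hu _] ->].
  have szS : (size (monics F n) <= size [seq (h + u)%R | h <- monics F n])%N by rewrite size_map.
  rewrite perm_sym; apply: uniq_perm; rewrite ?uniq_monics //.
  by have [_] := uniq_min_size uS subS szS.
suff : Lcoef n = psi t * Lcoef n.
  move/eqP; rewrite -subr_eq0 -{1}[Lcoef n]mul1r -mulrBl mulf_eq0 subr_eq0 eq_sym.
  by rewrite (negPf psit) => /eqP.
rewrite {1}/Lcoef (perm_big _ perm_shift) big_map mulr_sumr.
by apply: eq_big_seq => h /shift[].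
Qed.

End LFunction.

(** * Newton's identities and inverse roots *)

Section PowerSums.

Implicit Types (s : seq algC).

(** The logarithmic derivative of the product is minus the sum of the geometric series
    [a / (1 - a X)]. They are cut at degree [N], and [R] collects the error, so that only
    polynomials are involved. *)
Lemma prod_power_sums s N : exists R : {poly algC},
  (\prod_(a <- s) (1 - a *: 'X))^`() =
  - (\poly_(j < N) \sum_(a <- s) a ^+ j.+1) * \prod_(a <- s) (1 - a *: 'X) + 'X^N * R.
Proof.
elim: s => [|a s [R IHs]].
  exists 0; rewrite !big_nil mulr0 addr0 mulr1 -[X in X^`()]/(1%:P) derivC.
  apply/polyP=> i; rewrite coefN coef_poly coef0; case: ifP => _; last by rewrite oppr0.
  by rewrite big_nil oppr0.
pose geo := \poly_(j < N) a ^+ j.+1.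
have geoE : geo * (1 - a *: 'X) = a%:P - 'X^N * (a ^+ N.+1)%:P.
  apply/polyP=> i; rewrite mulrBr mulr1 -scalerAr ['X^N * _]mulrC mul_polyC !coefB !coefZ.
  rewrite coefMX coefC coefXn !coef_poly; case: i => [|i] /=.
    by rewrite mulr0 subr0; case: N {IHs geo} => [|N] /=; rewrite ?mulr1 ?mulr0 ?subr0 ?subrr.
  have [iN|iN|<-] := ltngtP i.+1 N.
  - by rewrite -exprS subrr mulr0 subr0.
  - by rewrite !mulr0.
  - by rewrite mulr1 -exprS sub0r.
pose M := \prod_(b <- s) (1 - b *: 'X).
exists ((1 - a *: 'X) * R - (a ^+ N.+1)%:P * M).
have -> : \poly_(j < N) (\sum_(b <- a :: s) b ^+ j.+1) =
    geo + \poly_(j < N) (\sum_(b <- s) b ^+ j.+1).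
  apply/polyP=> i; rewrite coefD !coef_poly; case: ifP => _; last by rewrite addr0.
  by rewrite big_cons.
rewrite big_cons derivM IHs -/M derivB derivZ derivX -[X in X^`()]/(1%:P) derivC sub0r.
have -> : - (a *: 1) * M = - (geo * (1 - a *: 'X)) * M - 'X^N * (a ^+ N.+1)%:P * M.
  by rewrite geoE -alg_polyC; ring.
by ring.
Qed.

(** Newton's identities, by comparing coefficients of degree [n - 1]; cutting at [N = n] keeps the
    error term out of that degree. *)
Lemma newton_power_sums s n :
  (\prod_(a <- s) (1 - a *: 'X))`_n *+ n =
  - \sum_(j < n) (\sum_(a <- s) a ^+ j.+1) * (\prod_(a <- s) (1 - a *: 'X))`_(n - j.+1).
Proof.
case: n => [|n]; first by rewrite mulr0n big_ord0 oppr0.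
have [R E] := prod_power_sums s n.+1; rewrite -coef_deriv E mulNr coefD coefN coefM.
rewrite coefXnM ltnSn addr0; congr (- _); apply: eq_bigr => j _.
by rewrite coef_poly ltn_ord subSS.
Qed.

(** The constant coefficient 1 excludes the root 0, so the inverses of the roots can serve as the
    [a], and it fixes the scalar in the factorization. *)
Lemma prod_of_constant_coef1 (p : {poly algC}) : p`_0 = 1 ->
  exists2 s, p = \prod_(a <- s) (1 - a *: 'X) & size s = (size p).-1.
Proof.
move=> p0; have [r pE] := closed_field_poly_normal p.
have pn0 : p != 0 by apply: contra_eq_neq p0 => ->; rewrite coef0 eq_sym oner_eq0.
have rn0 : 0 \notin r.
  rewrite -root_prod_XsubC -(rootZ _ _ (_ : lead_coef p != 0)) ?lead_coef_eq0 // -pE.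
  by rewrite /root horner_coef0 p0 oner_eq0.
exists [seq a^-1 | a <- r]; last first.
  by rewrite size_map pE size_scale ?lead_coef_eq0 // size_prod_XsubC.
rewrite big_map; have E : \prod_(a <- r) ('X - a%:P) =
    (\prod_(a <- r) - a) *: \prod_(a <- r) (1 - a^-1 *: 'X).
  elim: r rn0 {pE} => [|a r IHr]; first by rewrite !big_nil scale1r.
  rewrite inE negb_or eq_sym => /andP[a0 r0]; rewrite !big_cons IHr //.
  have -> : 'X - a%:P = (- a) *: (1 - a^-1 *: 'X).
    by rewrite scalerBr scalerA mulNr mulfV // scaleN1r opprK scaleNr alg_polyC addrC.
  by rewrite -scalerAl -scalerAr scalerA.
have c1 : lead_coef p * (\prod_(a <- r) - a) = 1.
  move: p0; rewrite {1}pE E scalerA coefZ -horner_coef0 horner_prod.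
  by rewrite [X in _ * X]big1 ?mulr1 // => a _; rewrite !hornerE ?mulr0 ?subr0.
by rewrite {1}pE E scalerA c1 scale1r.
Qed.

End PowerSums.

Section LFunctionRoots.

Variables (F : finFieldType) (psi : F -> algC) (f : {poly F}) (d : nat).
Hypotheses (psiC : add_char psi) (psiN1 : exists t, psi t != 1).
Hypotheses (sf : size f = d.+1) (d_gt0 : (0 < d)%N) (dF : d%:R != 0 :> F).

(** [L] has degree below [d], hence at most [d - 1] inverse roots. [Lpower_sum] and minus their
    power sums obey the same Newton recursion, whose newest term has coefficient [Lcoef 0 = 1]. *)
Lemma Lpower_sum_roots : exists2 s : seq algC, (size s <= d.-1)%N &
  forall j, (0 < j)%N -> Lpower_sum psi f j = - \sum_(a <- s) a ^+ j.
Proof.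
pose L := \poly_(n < d) Lcoef psi f n.
have LE n : L`_n = Lcoef psi f n.
  by rewrite coef_poly; case: ltnP => // dn; rewrite (Lcoef_eq0 psiC psiN1 sf).
have [s Ls ss] := @prod_of_constant_coef1 L (etrans (LE 0) (Lcoef0 f psiC)).
exists s; first by rewrite ss -!subn1 leq_sub2r // size_poly.
elim/ltn_ind=> -[|n] // IHn _.
have := newton_power_sums s n.+1; rewrite -Ls LE Lcoef_newton //.
under [X in _ = - X -> _]eq_bigr do rewrite LE.
rewrite !big_ord_recr /= subnn Lcoef0 // !mulr1 opprD.
have -> : \sum_(i < n) Lpower_sum psi f i.+1 * Lcoef psi f (n.+1 - i.+1) =
    - \sum_(i < n) (\sum_(a <- s) a ^+ i.+1) * Lcoef psi f (n.+1 - i.+1).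
  by rewrite -sumrN; apply: eq_bigr => i _; rewrite IHn ?ltnS // mulNr.
by move/addrI.
Qed.

End LFunctionRoots.

(** * Point count on Artin-Schreier curves *)

Section CoefSize.

Variable K : fieldType.
Implicit Types (P Q : {poly {poly K}}) (A : {poly K}).

(** An element of [{poly {poly K}}] is a polynomial in Y over [K[X]]; this bounds its degree in X,
    while [size] measures the degree in Y. *)
Definition coef_size_le P n := forall j, (size (P`_j)%R <= n)%N.

Lemma coef_size_leW P m n : (m <= n)%N -> coef_size_le P m -> coef_size_le P n.
Proof. by move=> mn Pm j; apply: leq_trans mn. Qed.

Lemma coef_size_leD P Q n : coef_size_le P n -> coef_size_le Q n -> coef_size_le (P + Q) n.
Proof.
by move=> Pn Qn j; rewrite coefD (leq_trans (size_polyD _ _)) // geq_max Pn Qn.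
Qed.

Lemma coef_size_le_sum (I : Type) (s : seq I) (C : pred I) (E : I -> {poly {poly K}}) n :
  (forall i, C i -> coef_size_le (E i) n) -> coef_size_le (\sum_(i <- s | C i) E i) n.
Proof.
move=> En; apply: (big_ind (coef_size_le^~ n)) => //; last by move=> ? ?; apply: coef_size_leD.
by move=> j; rewrite coef0 size_poly0.
Qed.

Lemma coef_size_leM P Q m n k : coef_size_le P m -> coef_size_le Q n ->
  ((m + n).-1 <= k)%N -> coef_size_le (P * Q) k.
Proof.
move=> Pm Qn mnk j; rewrite coefM; apply: (leq_trans (size_sum _ _ _)).
by apply/bigmax_leqP => i _; apply: (size_mul_le (Pm _) (Qn _)).
Qed.

Lemma coef_size_leC A n : (size A <= n)%N -> coef_size_le A%:P n.
Proof. by move=> sA j; rewrite coefC; case: eqP => // _; rewrite size_poly0. Qed.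

Lemma coef_size_leXn e : coef_size_le 'X^e 1.
Proof.
by move=> j; rewrite coefXn; case: eqP => _; rewrite ?size_poly1 ?size_poly0.
Qed.

Lemma coef_size_leZ A P m n k : (size A <= m)%N -> coef_size_le P n ->
  ((m + n).-1 <= k)%N -> coef_size_le (A *: P) k.
Proof.
by rewrite -mul_polyC => /coef_size_leC Am Pn; apply: coef_size_leM.
Qed.

Lemma coef_size_le_exp P m e : coef_size_le P m.+1 -> coef_size_le (P ^+ e) (e * m).+1.
Proof.
move=> Pm; elim: e => [|e IHe]; first by rewrite expr0; apply: (coef_size_leXn 0).
by rewrite exprS; apply: (coef_size_leM Pm IHe); rewrite mulSn; lia.
Qed.

End CoefSize.

Section ArtinSchreierReduction.

Variables (K : fieldType) (p d : nat) (f : {poly K}).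
Hypothesis p_gt1 : (1 < p)%N.
Implicit Types (P Q : {poly {poly K}}).

(* Normal form of P in K[X][Y] / (Y^p - Y - f), provided P has degree at most 2p - 2 in Y. *)
Definition as_reduce P := take_poly p P + drop_poly p P * ('X + f%:P).

Lemma as_reduceD : {morph as_reduce : P Q / P + Q}.
Proof. by move=> P Q; rewrite /as_reduce take_polyD drop_polyD; ring. Qed.

Lemma as_reduce_id P : (size P <= p)%N -> as_reduce P = P.
Proof. by move=> sP; rewrite /as_reduce take_poly_id // drop_poly_eq0 // mul0r addr0. Qed.

Lemma size_as_reduce P : (size P <= (p + p).-1)%N -> (size (as_reduce P) <= p)%N.
Proof.
move=> sP; rewrite (leq_trans (size_polyD _ _)) // geq_max size_take_poly /=.
have sD : (size (drop_poly p P) <= p.-1)%N.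
  by rewrite size_drop_poly -subn1 -(leq_add2r p); have {}sP : (size P <= (p + p).-1)%N := sP; lia.
by apply: (size_mul_le sD (eq_leq (size_XaddC f))); lia.
Qed.

Hypothesis sf : size f = d.+1.

Lemma coef_size_le_reduce P n : coef_size_le P n -> coef_size_le (as_reduce P) (n + d).
Proof.
move=> Pn; apply: coef_size_leD => [j|].
  rewrite coef_take_poly; case: ifP => _; last by rewrite size_poly0.
  exact: leq_trans (Pn j) (leq_addr _ _).
apply: (@coef_size_leM _ _ _ n d.+1); last by rewrite addnS.
  by move=> j; rewrite coef_drop_poly.
apply: coef_size_leD; last by apply: coef_size_leC; rewrite sf.
exact: coef_size_leW (coef_size_leXn _ 1).
Qed.

Lemma horner_as_reduce P x y : y ^+ p = y + f.[x] ->
  (as_reduce P).[y%:P].[x] = P.[y%:P].[x].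
Proof.
move=> yp; rewrite -[P in RHS](poly_take_drop p) /as_reduce.
by rewrite !(hornerE, hornerXn) yp.
Qed.

End ArtinSchreierReduction.

Lemma exprD_pchar (R : comNzRingType) (p a : nat) (x y : R) : p \in [pchar R] ->
  (x + y) ^+ (p ^ a) = x ^+ (p ^ a) + y ^+ (p ^ a).
Proof.
move=> pR; rewrite exprDn_pchar // pnatX pnatE ?(pcharf_prime pR) //.
by rewrite pR.
Qed.

Lemma sum_exp_pchar (R : comNzRingType) (p a : nat) (I : Type) (s : seq I) (C : pred I) (E : I -> R) :
  p \in [pchar R] -> (\sum_(i <- s | C i) E i) ^+ (p ^ a) = \sum_(i <- s | C i) E i ^+ (p ^ a).
Proof.
move=> pR; apply: (big_morph (fun x => x ^+ (p ^ a)%N)) => [x y|].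
  exact: exprD_pchar.
by rewrite expr0n expn_eq0 (gtn_eqF (prime_gt0 (pcharf_prime pR))).
Qed.

Lemma natr_inj_pchar (R : nzRingType) (p k l : nat) : p \in [pchar R] ->
  (k < p)%N -> (l < p)%N -> k%:R = l%:R :> R -> k = l.
Proof.
move=> pR; wlog le : k l / (k <= l)%N.
  by move=> H kp lp E; case/orP: (leq_total k l) => /H-> //.
move=> kp lp E; have : (p %| l - k)%N by rewrite (dvdn_pcharf pR) natrB // E subrr.
have [lk _|lk] := posnP (l - k); first by apply/eqP; rewrite eqn_leq le -subn_eq0 lk.
by rewrite gtnNdvd // (leq_ltn_trans (leq_subr _ _)).
Qed.

(** * Stepanov's method for the curves y^p = y + f(x) *)

Section Stepanov.

Variables (K : finFieldType) (p b d : nat) (f : {poly K}).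
Hypotheses (pK : p \in [pchar K]) (b_gt0 : (0 < b)%N) (d_gt1 : (1 < d)%N).
Hypotheses (sf : size f = d.+1) (pd : ~~ (p %| d)%N).
(** The field has order [r^2] and [r] is the exponent in the sum of [u_s s^r]; [q = r / p] bounds
    the degree in x of the [u_s]. *)
Let q := (p ^ b)%N.
Let r := (p ^ b.+1)%N.
Hypothesis cardK : #|K| = (r ^ 2)%N.

Let p_pr : prime p := pcharf_prime pK.
Let p_gt1 : (1 < p)%N := prime_gt1 p_pr.

Let q_gt1 : (1 < q)%N.
Proof. by rewrite /q -(exp1n b) ltn_exp2r. Qed.

Let rE : r = (p * q)%N.
Proof. by rewrite /r expnS. Qed.

(** Taking successive [p]-th powers of [y^p = y + f(x)] and adding up gives [y^r = y + T(x)] on the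
    curve. *)
Let T : {poly K} := \sum_(i < b.+1) f ^+ (p ^ i).

Let size_fX n : size (f ^+ n) = (d * n).+1.
Proof.
have f0 : f != 0 by rewrite -size_poly_gt0 sf.
by rewrite -[LHS]prednK ?size_poly_gt0 ?expf_neq0 // size_exp sf.
Qed.

Let size_T : size T = (d * q).+1.
Proof.
rewrite /T big_ord_recr /= addrC size_polyDl size_fX // ltnS.
apply: (leq_trans (size_sum _ _ _)); apply/bigmax_leqP => i _; rewrite size_fX.
by rewrite ltn_mul2l (ltn_trans _ d_gt1) //= ltn_exp2l.
Qed.

Lemma as_point_pow x y : y ^+ p = y + f.[x] -> y ^+ r = y + T.[x].
Proof.
move=> xy; rewrite /r /T; elim: (b.+1) => [|n IHn].
  by rewrite big_ord0 horner0 addr0 expn0 expr1.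
rewrite expnS exprM xy exprD_pchar // IHn big_ord_recr /= hornerD horner_exp.
by rewrite addrA.
Qed.

(* Coefficients of the auxiliary polynomial: the entry (i, e, j, l) belongs to x^l y^j (x^i y^e)^r. *)
Let ix : finType := (('I_(q + d) * 'I_p) * ('I_p * 'I_q))%type.
Implicit Types (c : {ffun ix -> K}).

Let ucoef c (ie : 'I_(q + d) * 'I_p) : {poly {poly K}} :=
  \sum_(jl : 'I_p * 'I_q) (c (ie, jl) *: 'X^(jl.2)) *: 'X^(jl.1).

Let YT : {poly {poly K}} := 'X + T%:P.

(** The function [G], sum of [u_s s^r], with [y^r] rewritten as [y + T(x)] and then reduced to
    degree below [p] in Y. *)
Let aux c : {poly {poly K}} :=
  \sum_(ie : 'I_(q + d) * 'I_p) 'X^(ie.1 * r) *: as_reduce p f (ucoef c ie * YT ^+ ie.2).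

(* The reduction of aux c ^ r on the curve, using x^(r^2) = x and y^(r^2) = y. *)
Let aux_pow c : {poly {poly K}} :=
  \sum_(ie : 'I_(q + d) * 'I_p) 'X^(ie.1) *: as_reduce p f
    (\sum_(jl : 'I_p * 'I_q) (c (ie, jl) ^+ r *: 'X^(jl.2 * r)) *: (YT ^+ jl.1 * 'X^(ie.2))).

(** The unknowns enter [aux_pow] through their [r]-th powers, which makes it additive, though not
    linear over [K]. *)
Let aux_powB c c' : aux_pow (c - c') = aux_pow c - aux_pow c'.
Proof.
apply/eqP; rewrite eq_sym subr_eq -big_split /=; apply/eqP; apply: eq_bigr => ie _.
rewrite -scalerDr -as_reduceD -big_split /=; congr (_ *: as_reduce p f _).
apply: eq_bigr => jl _; rewrite -!scalerDl -exprD_pchar //.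
by rewrite !ffunE subrK.
Qed.

Let size_YT e : size (YT ^+ e) = e.+1.
Proof.
have YT0 : YT != 0 by rewrite -size_poly_gt0 size_XaddC.
by rewrite -[LHS]prednK ?size_poly_gt0 ?expf_neq0 // size_exp size_XaddC mul1n.
Qed.

Let aux_eval c x y : y ^+ p = y + f.[x] ->
  (aux c).[y%:P].[x] ^+ r = (aux_pow c).[y%:P].[x].
Proof.
move=> xy; have yr := as_point_pow xy.
have powQ (z : K) n : z ^+ (n * r) ^+ r = z ^+ n.
  by rewrite -exprM -mulnA mulnn -cardK mulnC exprM expf_card.
rewrite /aux /aux_pow !horner_sum sum_exp_pchar //; apply: eq_bigr => ie _.
rewrite !hornerZ !hornerM !horner_as_reduce // !hornerXn exprMn powQ; congr (_ * _).
rewrite !(hornerM, horner_exp) !(hornerD, hornerX, hornerC) -yr exprMn !horner_sum.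
rewrite sum_exp_pchar // mulr_suml; apply: eq_bigr => jl _.
rewrite !(hornerZ, hornerM, horner_exp, hornerXn, hornerD, hornerX, hornerC) -yr.
rewrite -/r !exprMn -[y ^+ r ^+ ie.2]exprM [(r * ie.2)%N]mulnC powQ -!exprM.
by rewrite [(r * jl.1)%N]mulnC mulrA.
Qed.

Let coef_size_YT e : coef_size_le (YT ^+ e) (e * (d * q)).+1.
Proof.
apply: coef_size_le_exp; apply: coef_size_leD.
  exact: coef_size_leW (coef_size_leXn _ 1).
by apply: coef_size_leC; rewrite size_T.
Qed.

(** A bound for the size of [aux_pow] in X; the terms come from [x^(l r)], [(y + T)^j], the
    reduction and [x^i]. *)
Let D := ((q - 1) * r + (p - 1) * (d * q) + d + (q + d))%N.

Let aux_pow_bounds c : (size (aux_pow c) <= p)%N /\ coef_size_le (aux_pow c) D.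
Proof.
have le_ord n (i : 'I_n) : (i <= n - 1)%N by rewrite subn1 -ltnS prednK ?(leq_ltn_trans _ (ltn_ord i)).
split.
  apply: (leq_trans (size_sum _ _ _)); apply/bigmax_leqP => ie _.
  apply: (leq_trans (size_scale_leq _ _)); apply: size_as_reduce => //.
  apply: (leq_trans (size_sum _ _ _)).
  apply/bigmax_leqP => jl _; apply: (leq_trans (size_scale_leq _ _)).
  apply: (size_mul_le (eq_leq (size_YT _)) (eq_leq (size_polyXn _ _))).
  by move: (nat_of_ord jl.1) (nat_of_ord ie.2) (ltn_ord jl.1) (ltn_ord ie.2) => m n; lia.
apply: coef_size_le_sum => ie _.
apply: (@coef_size_leZ _ _ _ (q + d) (((q - 1) * r + (p - 1) * (d * q)).+1 + d)).
- by rewrite size_polyXn.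
- apply: (coef_size_le_reduce p sf); apply: coef_size_le_sum => jl _.
  apply: (@coef_size_leZ _ _ _ ((q - 1) * r).+1 ((p - 1) * (d * q)).+1).
  + rewrite (leq_trans (size_scale_leq _ _)) // size_polyXn ltnS leq_mul2r le_ord.
    by rewrite orbT.
  + apply: (coef_size_leM (coef_size_YT _) (coef_size_leXn _ _)).
    by rewrite addn1 /= ltnS leq_mul2r le_ord orbT.
  + by rewrite addSn addnS.
- by rewrite /D; lia.
Qed.

(** The left side counts the coefficients of [aux_pow], the right side the unknowns. Divided by [p]
    and expanded, this is [q + 2 d < p q + d q]. *)
Let unknowns_gt : (p * D < (q + d) * p * (p * q))%N.
Proof.
rewrite [((q + d) * p)%N]mulnC -!mulnA ltn_pmul2l ?prime_gt0 // /D rE.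
have e1 : ((q - 1) * (p * q) + p * q = q * (p * q))%N.
  by rewrite mulnBl mul1n subnK // leq_pmull // ltnW.
have e2 : ((p - 1) * (d * q) + d * q = d * (p * q))%N.
  by rewrite mulnBl mul1n subnK ?leq_pmull ?(ltnW p_gt1) // mulnCA.
have e3 : (d * 2 <= d * q)%N by rewrite leq_mul2l q_gt1 orbT.
have e4 : (q < p * q)%N by rewrite ltn_Pmull // ltnW.
rewrite mulnDl -e1 -e2; move: e3 e4; clear.
move: ((q - 1) * (p * q))%N ((p - 1) * (d * q))%N (p * q)%N (d * q)%N => u v w z; lia.
Qed.

(** Pigeonhole: there are more families of unknowns than possible values of [aux_pow]; by
    additivity, the difference of two families with the same value is a solution. *)
Let exists_aux : exists2 c, c != 0 & aux_pow c = 0.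
Proof.
pose Phi c : {ffun 'I_p * 'I_D -> K} := [ffun z : 'I_p * 'I_D => ((aux_pow c)`_(z.1))`_(z.2)].
have /injectivePn[c1 [c2 c12 E]] : ~~ injectiveb Phi.
  apply/negP=> /injectiveP/leq_card; apply/negP; rewrite -ltnNge !card_ffun.
  rewrite !card_prod !card_ord ltn_exp2l ?unknowns_gt //.
  exact: finNzRing_gt1.
exists (c1 - c2); first by rewrite subr_eq0.
rewrite aux_powB; apply/eqP; rewrite subr_eq0; apply/eqP.
have [s1 b1] := aux_pow_bounds c1; have [s2 b2] := aux_pow_bounds c2.
apply/polyP=> j; have [jp|pj] := ltnP j p; last first.
  by rewrite (nth_default 0 (leq_trans s1 pj)) (nth_default 0 (leq_trans s2 pj)).
apply/polyP=> t; have [tD|Dt] := ltnP t D; last first.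
  by rewrite (nth_default 0 (leq_trans (b1 j) Dt)) (nth_default 0 (leq_trans (b2 j) Dt)).
by move/ffunP/(_ (Ordinal jp, Ordinal tD)): E; rewrite !ffunE.
Qed.

Let coef_ucoef c ie (j : 'I_p) (l : 'I_q) : ((ucoef c ie)`_j)`_l = c (ie, (j, l)).
Proof.
rewrite /ucoef !coef_sum (bigD1 (j, l)) //= big1 ?addr0 => [|[j' l'] jl].
  by rewrite coefZ coefXn eqxx mulr1 coefZ coefXn eqxx mulr1.
rewrite coefZ coefXn; have [Ej|] := eqVneq (nat_of_ord j) j'; last by rewrite mulr0 coef0.
rewrite mulr1 coefZ coefXn; have [El|] := eqVneq (nat_of_ord l) l'; last by rewrite mulr0.
by case/eqP: jl; rewrite (val_inj Ej) (val_inj El).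
Qed.

Let ucoef_bounds c ie : (size (ucoef c ie) <= p)%N /\ coef_size_le (ucoef c ie) q.
Proof.
split.
  apply: (leq_trans (size_sum _ _ _)); apply/bigmax_leqP => jl _.
  by apply: (leq_trans (size_scale_leq _ _)); rewrite size_polyXn.
apply: coef_size_le_sum => jl _; apply: (coef_size_leZ _ (coef_size_leXn _ _)) (_ : (q + 1).-1 <= q)%N; last by rewrite addn1.
by apply: (leq_trans (size_scale_leq _ _)); rewrite size_polyXn.
Qed.

Let dq_ge : (q + d <= d * q)%N.
Proof. by have := q_gt1; have := d_gt1; clear; move: q => n; nia. Qed.

(* Since T has degree d q >= q + d, reduction only affects lower order terms. *)
Let reduce_lead (u : {poly {poly K}}) e : (e < p)%N -> (size u <= p)%N -> coef_size_le u q ->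
  exists2 V, as_reduce p f (u * YT ^+ e) = (T ^+ e) *: u + V & coef_size_le V (e * (d * q)).
Proof.
move=> ep su cu; case: e ep => [|e] ep.
  exists 0; last by move=> j; rewrite coef0 size_poly0.
  by rewrite !expr0 mulr1 scale1r addr0 as_reduce_id.
(* [Y W] is [(Y + T)^(e+1) - T^(e+1)], so [W] has one factor [T] fewer; the degree [d q] saved pays
   for [u] and for the reduction. *)
pose W := \sum_(i < e.+1) YT ^+ (e.+1.-1 - i) * T%:P ^+ i.
have E : u * YT ^+ e.+1 = T ^+ e.+1 *: u + u * ('X * W).
  have -> : 'X * W = YT ^+ e.+1 - T%:P ^+ e.+1 by rewrite subrXX /YT addrK.
  by rewrite mulrBr -mul_polyC polyC_exp [_ * u]mulrC addrC subrK.
rewrite E as_reduceD as_reduce_id; last by apply: leq_trans su; apply: size_scale_leq.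
eexists; first reflexivity.
have cW : coef_size_le W (e * (d * q)).+1.
  apply: coef_size_le_sum => i _; rewrite -polyC_exp.
  apply: (coef_size_leM (coef_size_YT _) (@coef_size_leC _ _ (i * (d * q)).+1 _)).
    by rewrite -[size _]prednK ?size_poly_gt0 ?expf_neq0 -?size_poly_gt0 ?size_T // size_exp size_T mulnC.
  by rewrite addSn addnS /= ltnS -mulnDl leq_mul2r subnK ?leqnn ?orbT // -ltnS.
apply: (coef_size_leW _ (coef_size_le_reduce p sf (n := (q + e * (d * q))%N) _)).
  by have := dq_ge; rewrite mulSn; lia.
apply: (@coef_size_leM _ _ _ q (e * (d * q)).+1); rewrite ?addnS //.
by apply: (coef_size_leM (coef_size_leXn _ 1) cW).
Qed.

(** The pole order of [x^i y^e] at infinity, where [x] has order [p] and [y] has order [d]; times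
    [q] it is the degree of [x^(i r) T^e]. *)
Let weight (ie : 'I_(q + d) * 'I_p) := (ie.1 * p + ie.2 * d)%N.

(** The prime [p] does not divide [d], so the weight determines [e] modulo [p], hence [e < p]
    itself, and then [i]. *)
Let weight_inj : injective weight.
Proof.
have le_case i i' e e' : (e' <= e)%N -> (e < p)%N ->
    (i * p + e * d = i' * p + e' * d)%N -> e = e'.
  move=> le ep E; have {}E : ((e - e') * d = (i' - i) * p)%N by rewrite !mulnBl; lia.
  have := dvdn_mull (i' - i) (dvdnn p); rewrite -E Euclid_dvdM // (negPf pd) orbF.
  have [e0 _|e0] := posnP (e - e'); first by apply/eqP; rewrite eqn_leq le -subn_eq0 e0.
  by rewrite gtnNdvd // (leq_ltn_trans (leq_subr _ _)).
move=> [i e] [i' e']; rewrite /weight /= => E.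
have Ee : e = e'.
  apply: val_inj => /=; case/orP: (leq_total e' e) => le.
    exact: (le_case _ _ _ _ le (ltn_ord e) E).
  exact/esym/(le_case _ _ _ _ le (ltn_ord e') (esym E)).
move: E; rewrite Ee => /addIn/eqP; rewrite eqn_pmul2r ?prime_gt0 // => /eqP Ei.
by rewrite (val_inj Ei).
Qed.

(** Among the nonzero [u_s], the one of largest weight gives a term that no other cancels: weights
    differ by at least 1, so the degrees [q * weight] differ by at least [q], while each [u_s] has
    degree below [q] in x. *)
Let aux_neq0 c : c != 0 -> aux c != 0.
Proof.
move=> c0.
have [ie0 u0] : exists ie, ucoef c ie != 0.
  apply/existsP; apply: contraNT c0 => /existsPn u0; apply/eqP/ffunP => -[ie [j l]].
  by rewrite -coef_ucoef; have /negPn/eqP-> := u0 ie; rewrite !coef0 ffunE.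
case: (@arg_maxnP _ ie0 (fun ie => ucoef c ie != 0) weight u0) => ie uie ie_max.
have [j uj] : exists j, (ucoef c ie)`_j != 0.
  by exists (size (ucoef c ie)).-1; rewrite -lead_coefE lead_coef_eq0.
(* Degrees in X are compared in the coefficient of one [Y^j] occurring in the dominating [u_s]. *)
apply/eqP => /(congr1 (fun P : {poly {poly K}} => size P`_j)).
rewrite coef0 size_poly0 /aux (bigD1 ie) //= coefD coefZ.
have [su cu] := ucoef_bounds c ie.
have [V -> cV] := reduce_lead (ltn_ord ie.2) su cu.
rewrite coefD coefZ mulrDr -addrA.
set A := 'X^_ * (_ * _); set B := _ * V`_j + _.
have T0 : T != 0 by rewrite -size_poly_gt0 size_T.
have sTe e : size (T ^+ e) = (e * (d * q)).+1.
  by rewrite -[LHS]prednK ?size_poly_gt0 ?expf_neq0 // size_exp size_T mulnC.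
have sA : (q * weight ie < size A)%N.
  rewrite /A size_mul ?mulf_neq0 ?expf_neq0 ?polyX_eq0 // size_polyXn.
  rewrite size_mul ?expf_neq0 // sTe /weight rE.
  have : (0 < size ((ucoef c ie)`_j)%R)%N by rewrite size_poly_gt0.
  rewrite mulnDr !mulnA; move: (size _) => n.
  have -> : (ie.1 * p * q = q * ie.1 * p)%N by ring.
  have -> : (ie.2 * d * q = q * ie.2 * d)%N by ring.
  by move: (q * ie.1 * p)%N (q * ie.2 * d)%N => u v; lia.
have sB : (size B <= q * weight ie)%N.
  apply: (leq_trans (size_polyD _ _)); rewrite geq_max; apply/andP; split.
    apply: (size_mul_le (eq_leq (size_polyXn _ _)) (cV j)).
    by rewrite /weight rE; apply/eq_leq; rewrite addSn /= mulnDr; congr (_ + _)%N; ring.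
  rewrite coef_sum; apply: (leq_trans (size_sum _ _ _)); apply/bigmax_leqP => ie' ie'N.
  rewrite coefZ; have [su' cu'] := ucoef_bounds c ie'.
  have [->|u'0] := eqVneq (ucoef c ie') 0.
    by rewrite mul0r as_reduce_id ?size_poly0 // coef0 mulr0 size_poly0.
  have lt_w : (weight ie' < weight ie)%N.
    by rewrite ltn_neqAle (inj_eq weight_inj) ie'N; apply: ie_max.
  have [V' -> cV'] := reduce_lead (ltn_ord ie'.2) su' cu'.
  have sR : (size ((T ^+ ie'.2 *: ucoef c ie' + V')`_j)%R <= ie'.2 * (d * q) + q)%N.
    rewrite coefD coefZ (leq_trans (size_polyD _ _)) // geq_max; apply/andP; split.
      by apply: (size_mul_le (eq_leq (sTe _)) (cu' j)).
    exact: leq_trans (cV' j) (leq_addr _ _).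
  apply: (size_mul_le (eq_leq (size_polyXn _ _)) sR); rewrite rE addSn /=.
  apply: (@leq_trans (q * (weight ie').+1)); last by rewrite leq_mul2l lt_w orbT.
  by apply/eq_leq; rewrite /weight; ring.
by rewrite size_polyDl ?(leq_ltn_trans sB) // => sA0; rewrite sA0 in sA.
Qed.
Let aux_bounds c : (size (aux c) <= p)%N /\
  coef_size_le (aux c) ((q + d - 1) * r + (p - 1) * (d * q) + q + d).
Proof.
have le_ord n (i : 'I_n) : (i <= n - 1)%N by rewrite subn1 -ltnS prednK ?(leq_ltn_trans _ (ltn_ord i)).
split.
  apply: (leq_trans (size_sum _ _ _)); apply/bigmax_leqP => ie _.
  apply: (leq_trans (size_scale_leq _ _)); apply: size_as_reduce => //.
  have [su _] := ucoef_bounds c ie; apply: (size_mul_le su (eq_leq (size_YT _))).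
  by move: (nat_of_ord ie.2) (ltn_ord ie.2) => m; lia.
apply: coef_size_le_sum => ie _; have [_ cu] := ucoef_bounds c ie.
have cuY : coef_size_le (ucoef c ie * YT ^+ ie.2) (q + (p - 1) * (d * q)).
  by apply: (coef_size_leM cu (coef_size_YT _)); rewrite addnS /= leq_add2l leq_mul2r le_ord orbT.
apply: (coef_size_leZ (eq_leq (size_polyXn _ _)) (coef_size_le_reduce p sf cuY)).
rewrite addSn /=; have : (ie.1 * r <= (q + d - 1) * r)%N by rewrite leq_mul2r le_ord orbT.
move: (nat_of_ord ie.1 * r)%N ((q + d - 1) * r)%N ((p - 1) * (d * q))%N => u v w; clear; lia.
Qed.

(** A nonzero coefficient of some [Y^j] in [aux c] vanishes at the abscissa of every rational point;
    its size bounds the number of abscissas, and each carries at most [p] points. *)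
Lemma artin_schreier_bound :
  (#|[set z : K * K | (z.2 ^+ p == z.2 + f.[z.1])%R]| <= r ^ 2 + 2 * p * d * r)%N.
Proof.
have [c c0 Hc] := exists_aux; have [sG cG] := aux_bounds c.
have [j Gj] : exists j, (aux c)`_j != 0.
  by exists (size (aux c)).-1; rewrite -lead_coefE lead_coef_eq0 aux_neq0.
pose X := [set x : K | [exists y : K, y ^+ p == y + f.[x]]].
have rootX x : x \in X -> root (aux c)`_j x.
  rewrite inE => /existsP[y /eqP xy].
  pose g : {poly K} := map_poly (horner_eval x) (aux c).
  suff g0 : g = 0 by have := congr1 (fun h : {poly K} => h`_j) g0; rewrite coef_map coef0 => /eqP.
  apply/eqP; apply: contraT => gn0.
  have sg : (size g <= p)%N by apply: leq_trans (size_poly _ _) sG.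
  (* With [y], all [y + k] for [k < p] lie on the curve above [x]. A polynomial of degree below [p]
     in Y vanishing at these [p] values is 0, so every coefficient of [aux c] vanishes at [x]. *)
  pose ys := [seq y + k%:R | k <- iota 0 p].
  have uys : uniq ys.
    rewrite map_inj_in_uniq ?iota_uniq // => k l; rewrite !mem_iota !add0n /= => kp lp /addrI.
    exact: natr_inj_pchar pK kp lp.
  have /(max_poly_roots gn0)/(_ uys) : all (root g) ys.
    apply/allP=> _ /mapP[k _ ->]; apply/eqP.
    have xyk : (y + k%:R) ^+ p = y + k%:R + f.[x].
      rewrite -[p in LHS]expn1 exprD_pchar // expn1 xy addrAC; congr (_ + _).
      by rewrite -(pFrobenius_autE pK) rmorph_nat.
    have := aux_eval c xyk; rewrite Hc !horner0 => /eqP; rewrite expf_eq0 => /andP[_ /eqP].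
    have E : (y + k%:R) = horner_eval x (y + k%:R)%:P by rewrite horner_evalE hornerC.
    by rewrite [X in g.[X]]E horner_map.
  by rewrite size_map size_iota ltnNge sg.
have cardX : (#|X| < size ((aux c)`_j)%R)%N.
  rewrite cardE; apply: max_poly_roots; rewrite ?enum_uniq //.
  by apply/allP=> x; rewrite mem_enum => /rootX.
pose Y x := [set y : K | y ^+ p == y + f.[x]].
have fibre x : (#|Y x| <= p * (x \in X))%N.
  case: (boolP (x \in X)) => xX; last first.
    rewrite muln0 leqn0 cards_eq0; apply/eqP/setP => y; rewrite !inE.
    by apply: contraNF xX => xy; rewrite inE; apply/existsP; exists y.
  rewrite muln1 cardE; pose h : {poly K} := 'X^p - ('X + (f.[x])%:P).
  have sh : size h = p.+1.
    by rewrite /h size_polyDl size_polyXn // size_polyN size_XaddC.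
  rewrite -ltnS -sh; apply: max_poly_roots; rewrite ?enum_uniq //.
    by rewrite -size_poly_gt0 sh.
  by apply/allP=> y; rewrite mem_enum inE /root !(hornerE, hornerXn) subr_eq0.
have -> : #|[set z : K * K | z.2 ^+ p == z.2 + f.[z.1]]| =
    (\sum_x #|Y x|)%N.
  under [RHS]eq_bigr => x _ do rewrite -sum1_card big_mkcond.
  rewrite pair_bigA -sum1_card big_mkcond; apply: eq_bigr => z _ /=.
  by rewrite !inE.
apply: (@leq_trans (p * #|X|)).
  rewrite -sum1_card big_distrr [in X in (_ <= X)%N]big_mkcond /=; apply: leq_sum => x _.
  by apply: leq_trans (fibre x) _; case: (x \in X); rewrite ?muln0.
have {cardX} := leq_trans cardX (cG j).
move: #|X| => n; rewrite rE => n_lt.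
have e1 : ((q + d - 1) * (p * q) + p * q = q * (p * q) + d * (p * q))%N.
  by rewrite mulnBl mul1n subnK ?mulnDl // -mulnDl leq_pmull // addn_gt0 (ltnW q_gt1).
have e2 : ((p - 1) * (d * q) + d * q = d * (p * q))%N.
  by rewrite mulnBl mul1n subnK ?leq_pmull ?(ltnW p_gt1) // mulnCA.
have e3 : (q <= p * q)%N by rewrite leq_pmull // ltnW.
have e4 : (d <= d * q)%N by rewrite leq_pmulr // ltnW.
have n_le : (n <= q * (p * q) + 2 * (d * (p * q)))%N.
  move: n_lt e1 e2 e3 e4; clear.
  move: ((q + d - 1) * (p * q))%N ((p - 1) * (d * q))%N (q * (p * q))%N (d * (p * q))%N.
  by move: (p * q)%N (d * q)%N => u v w x y z; lia.
by apply: (leq_trans (leq_mul (leqnn p) n_le)); apply/eq_leq; ring.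
Qed.

End Stepanov.

(** * Finite extensions of a finite field *)

Lemma finite_extension (F : finFieldType) (n : nat) : (0 < n)%N ->
  exists (K : finFieldType) (iota : {rmorphism F -> K}), #|K| = (#|F| ^ n)%N.
Proof.
move=> n0; pose m := (#|F| ^ n)%N.
have F1 : (1 < #|F|)%N := finNzRing_gt1 F.
have m1 : (1 < m)%N by rewrite -(exp1n n) ltn_exp2r.
have [p p_pr pF] := finPcharP F.
have qE (R : nzRingType) : 'X^m - 'X = ('X^(m.-1) - 1) * ('X - 0) :> {poly R}.
  by rewrite subr0 mulrBl mul1r -exprSr prednK // ltnW.
have /FinSplittingFieldFor[L] : 'X^m - 'X != 0 :> {poly F}.
  by rewrite qE monic_neq0 // rpredM ?monicXsubC // monicXnsubC // -subn1 subn_gt0.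
rewrite rmorphB /= rmorphXn /= map_polyX => -[zs DqL defL].
have pL : p \in [pchar L] by rewrite pchar_lalg.
have m0 : m%:R = 0 :> L.
  have [k Fk] : exists k, #|F| = (p ^ k)%N by exists (logn p #|F|); apply: (card_pprimeChar pF).
  have k0 : (0 < k)%N by move: F1; rewrite Fk; case: (k).
  by rewrite /m Fk -expnM natrX (pcharf0 pL) expr0n muln_eq0 (gtn_eqF k0) (gtn_eqF n0).
have Uzs : uniq zs.
  rewrite -separable_prod_XsubC -(eqp_separable DqL) qE separable_root.
  rewrite cyclotomic.separable_Xn_sub_1; last by rewrite -subn1 natrB 1?ltnW // m0 sub0r oppr_eq0 oner_eq0.
  by rewrite /root !hornerE expr0n -subn1 subn_eq0 leqNgt m1 /= sub0r oppr_eq0 oner_eq0.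
have [a _ Da] := finField_galois_generator (sub1v {:L}).
rewrite /= dimv1 expn1 in Da.
(* The roots of [X^m - X] are the fixed points of the [n]-th power of Frobenius, so they form a
   field; as they generate [L], they exhaust it. *)
pose Em := fixedSpace (a ^+ n)%g.
have in_zs : zs =i Em.
  move=> z; rewrite -root_prod_XsubC -(eqp_root DqL) (sameP fixedSpaceP eqP).
  rewrite /root !hornerE subr_eq0 /m; congr (_ == z); elim: (n) => [|i IHi].
    by rewrite gal_id.
  by rewrite expgSr expnSr exprM IHi galM ?Da ?memvf.
have EmE : Em = {:L}%VS.
  apply/eqP; rewrite eqEsubv subvf -defL -[Em]subfield_closed agenvS //.
  by rewrite subv_add sub1v; apply/span_subvP=> z; rewrite in_zs.
pose K : finFieldType := FinFieldExtType L.
exists K, (in_alg L : {rmorphism F -> L}).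
have szs : size zs = m.
  apply: succn_inj; rewrite -(size_prod_XsubC _ id) -(eqp_size DqL).
  by rewrite size_polyDl size_polyXn // size_polyN size_polyX.
have /eq_card-> : K =i zs by move=> z; rewrite in_zs EmE memvf.
by rewrite (card_uniqP _).
Qed.

Lemma card_pchar (F : finFieldType) p : p \in [pchar F] -> #|F| = (p ^ logn p #|F|)%N.
Proof. by move=> pF; apply: (card_pprimeChar pF). Qed.

Lemma frobenius_rmorphism (K : comNzRingType) p e : p \in [pchar K] ->
  exists phi : {rmorphism K -> K}, forall x, phi x = x ^+ (p ^ e).
Proof.
move=> pK; elim: e => [|e [phi phiE]]; first by exists idfun => x; rewrite expn0 expr1.
exists (phi \o pFrobenius_aut pK) => x /=.
by rewrite phiE pFrobenius_autE -exprM expnS.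
Qed.

(** * Character sums over extension fields *)

Section FrobeniusOrbits.

Variables (F K : finFieldType) (iota : {rmorphism F -> K}) (n : nat).
Hypothesis cardK : #|K| = (#|F| ^ n)%N.
Local Notation "P ^K" := (map_poly iota P) (at level 2, format "P ^K").

Definition frob (x : K) := x ^+ #|F|.

Lemma frob_rmorphism : exists phi : {rmorphism K -> K}, phi =1 frob.
Proof.
have [p _ pF] := finPcharP F.
have pK : p \in [pchar K] by rewrite (fmorph_pchar iota).
have [phi phiE] := frobenius_rmorphism (logn p #|F|) pK.
by exists phi => x; rewrite phiE /frob [in RHS](card_pchar pF).
Qed.

Lemma frob_inj : injective frob.
Proof. by have [phi phiE] := frob_rmorphism => x y; rewrite -!phiE => /fmorph_inj. Qed.

Lemma iter_frob i x : iter i frob x = x ^+ (#|F| ^ i).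
Proof.
elim: i => [|i IHi]; first by rewrite expn0 expr1.
by rewrite iterS IHi /frob -exprM -expnSr.
Qed.

Lemma iter_frob_id x : iter n frob x = x.
Proof. by rewrite iter_frob -cardK expf_card. Qed.

Lemma frob_iota t : frob (iota t) = iota t.
Proof. by rewrite /frob -rmorphXn expf_card. Qed.

Lemma frob_fixed x : frob x = x -> exists t, x = iota t.
Proof.
move=> xq; have : root ('X^#|F| - 'X)^K x.
  by rewrite rmorphB /= map_polyXn map_polyX /root !(hornerE, hornerXn) -[_ ^+ _]/(frob x) xq subrr.
rewrite finField_genPoly rmorph_prod /= (eq_bigr (fun t => 'X - (iota t)%:P)) => [|t _]; last first.
  by rewrite rmorphB /= map_polyX map_polyC.
rewrite -(big_map iota xpredT (fun z => 'X - z%:P)) root_prod_XsubC => /mapP[t _ ->].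
by exists t.
Qed.

Lemma horner_frob (f : {poly F}) x : f^K.[frob x] = frob f^K.[x].
Proof.
have [phi phiE] := frob_rmorphism; rewrite -!phiE -horner_map; congr _.[_].
by apply/polyP=> i; rewrite !coef_map /= phiE frob_iota.
Qed.

Lemma poly_over_iota (p : {poly K}) : (forall i, frob p`_i = p`_i) -> exists h, p = h^K.
Proof.
move=> pE; have [t tE] : exists t : nat -> F, forall i, p`_i = iota (t i).
  pose t i := odflt 0 [pick t | p`_i == iota t]; exists t => i; rewrite /t.
  by case: pickP => [s /eqP //|]; have [s ->] := frob_fixed (pE i) => /(_ s)/eqP.
exists (\poly_(i < size p) t i); apply/polyP=> i; rewrite coef_map coef_poly.
case: ltnP => [_|pi]; first exact: tE.
by rewrite [LHS]nth_default //; apply/esym/(rmorph0 iota).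
Qed.

(** The minimal polynomial of [x] over [F], taken over [K]: the orbit consists of the conjugates of
    [x]. *)
Definition orbit_poly x : {poly K} := \prod_(z <- orbit frob x) ('X - z%:P).

Lemma orbit_poly_frob x i : frob (orbit_poly x)`_i = (orbit_poly x)`_i.
Proof.
have [phi phiE] := frob_rmorphism; rewrite -phiE -coef_map /=.
suff -> : map_poly phi (orbit_poly x) = orbit_poly x by [].
rewrite /orbit_poly rmorph_prod /= (eq_bigr (fun z => 'X - (frob z)%:P)) => [|z _]; last first.
  by rewrite rmorphB /= map_polyX map_polyC /= phiE.
have uS : uniq [seq frob z | z <- orbit frob x].
  by rewrite map_inj_uniq ?orbit_uniq //; apply: frob_inj.
have subS : {subset [seq frob z | z <- orbit frob x] <= orbit frob x}.
  by move=> _ /mapP[z zx ->]; apply: mem_orbit.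
have permS : perm_eq [seq frob z | z <- orbit frob x] (orbit frob x).
  apply: uniq_perm; rewrite ?orbit_uniq //.
  by have [_] := uniq_min_size uS subS (eq_leq (esym (size_map _ _))).
by rewrite -[RHS](perm_big _ permS) /= big_map.
Qed.

Lemma orbit_root (Q : {poly F}) x z : z \in orbit frob x -> root Q^K z -> all (root Q^K) (orbit frob x).
Proof.
rewrite -fconnect_orbit => xz Qz; apply/allP=> y; rewrite -fconnect_orbit => xy.
have /iter_findex <- : fconnect frob z y.
  by apply: connect_trans xy; rewrite fconnect_sym //; apply: frob_inj.
elim: (findex _ _ _) => //= i IHi; rewrite /root horner_frob (eqP IHi).
by rewrite /frob expr0n (gtn_eqF (ltnW (finNzRing_gt1 F))).
Qed.

(** A factor over [F] vanishing at one point of the orbit vanishes on all of it, so [orbit_poly x]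
    divides it. *)
Lemma orbit_poly_irred x :
  exists2 h, h \in irreds F (order frob x) & orbit_poly x = h^K.
Proof.
have [h hE] := poly_over_iota (orbit_poly_frob x); exists h => //.
have hm : h \is monic by rewrite -(map_monic iota) -hE monic_prod_XsubC.
have sh : size h = (order frob x).+1.
  by rewrite -(size_map_poly iota) -hE size_prod_XsubC size_orbit.
rewrite mem_filter mem_monics hm sh eqxx !andbT; apply/irredbP; split.
  by rewrite sh ltnS order_gt0.
move=> Q sQ Qh; have : Q^K %| orbit_poly x by rewrite hE dvdp_map.
move=> /dvdp_prod_XsubC[m QE].
have [z zx zQ] : exists2 z, z \in orbit frob x & root Q^K z.
  case Em: (mask m (orbit frob x)) QE => [|z s] QE.
    by move: QE; rewrite big_nil => /eqp_size; rewrite size_poly1 size_map_poly => /eqP; rewrite (negPf sQ).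
  exists z; first by apply: (mem_mask (m := m)); rewrite Em mem_head.
  by rewrite (eqp_root QE) big_cons rootM root_XsubC eqxx.
rewrite /eqp Qh -(dvdp_map iota) -hE /orbit_poly.
apply: uniq_roots_dvdp; first exact: orbit_root zx zQ.
by rewrite uniq_rootsE orbit_uniq.
Qed.

Lemma orbit_poly_unique r P x : P \in irreds F r -> root P^K x ->
  P^K = orbit_poly x /\ r = order frob x.
Proof.
move=> /mem_irreds[Pm sP r0 iP] Px; have [h hirr hE] := orbit_poly_irred x.
have [hm sh _ ih] := mem_irreds hirr.
have /orP[hP|] := irred_dvd_or_coprime P ih; last first.
  have rh : root h^K x by rewrite -hE root_prod_XsubC in_orbit.
  by rewrite -(coprimep_map iota) => /coprimep_root/(_ rh); rewrite (eqP Px) eqxx.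
have hPE := irred_monic_eq ih iP hm Pm hP.
by rewrite hE hPE; split=> //; apply: succn_inj; rewrite -sh -sP hPE.
Qed.

Lemma order_frob_dvd x : (order frob x %| n)%N.
Proof.
rewrite /dvdn; have ltm := ltn_pmod n (order_gt0 frob x).
rewrite -(findex_iter ltm) findex_eq0.
suff -> : iter (n %% order frob x) frob x = iter n frob x by rewrite iter_frob_id.
rewrite [in RHS](divn_eq n (order frob x)) addnC iterD; congr (iter _ _ _).
elim: (_ %/ _)%N => [|k IHk] //; rewrite mulSn iterD -IHk iter_order //.
exact: frob_inj.
Qed.

End FrobeniusOrbits.

Section ExtensionSum.

Variables (F K : finFieldType) (iota : {rmorphism F -> K}) (n : nat).
Hypotheses (n_gt0 : (0 < n)%N) (cardK : #|K| = (#|F| ^ n)%N).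
Local Notation "P ^K" := (map_poly iota P) (at level 2, format "P ^K").
Local Notation frob := (@frob F K).

Let tr z := \sum_(i < n) iter i frob z.

Let tr_fixed z : exists t, tr z = iota t.
Proof.
apply: frob_fixed; have [phi phiE] := frob_rmorphism iota.
rewrite -phiE rmorph_sum /= /tr; case: (n) (iter_frob_id cardK z) => [|m] zm.
  by rewrite !big_ord0.
rewrite big_ord_recr [in RHS]big_ord_recl /= !phiE -iterS zm addrC; congr (_ + _).
by apply: eq_bigr => i _; rewrite phiE.
Qed.

Definition field_trace z : F := odflt 0 [pick t | tr z == iota t].

Lemma field_traceE z : iota (field_trace z) = \sum_(i < n) z ^+ (#|F| ^ i).
Proof.
under eq_bigr do rewrite -iter_frob.
rewrite /field_trace; case: pickP => [t /eqP <- //|no_t].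
by have [t /eqP] := tr_fixed z; rewrite no_t.
Qed.

Lemma field_traceD : {morph field_trace : x y / x + y}.
Proof.
move=> x y; apply: (fmorph_inj iota); rewrite rmorphD /= !field_traceE -big_split.
have [p _ pF] := finPcharP F; have pK : p \in [pchar K] by rewrite (fmorph_pchar iota).
by apply: eq_bigr => i _; rewrite (card_pchar pF) -expnM exprD_pchar.
Qed.

Lemma field_traceZ c x : field_trace (iota c * x) = c * field_trace x.
Proof.
apply: (fmorph_inj iota); rewrite rmorphM /= !field_traceE mulr_sumr.
apply: eq_bigr => i _; rewrite exprMn; congr (_ * _); rewrite -iter_frob.
by elim: (nat_of_ord i) => //= j ->; rewrite frob_iota.
Qed.

(** The trace is a polynomial of degree [#|F|^(n-1)], too small to vanish on all of [K]; one nonzero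
    value yields the others by linearity. *)
Lemma field_trace_surj t : exists x, field_trace x = t.
Proof.
have [x trx] : exists x, field_trace x != 0.
  pose P : {poly K} := \sum_(i < n) 'X^(#|F| ^ i).
  have F1 := finNzRing_gt1 F.
  have sP : size P = (#|F| ^ n.-1).+1.
    rewrite /P; case: (n) n_gt0 => // m _; rewrite big_ord_recr /= addrC.
    rewrite size_polyDl size_polyXn // ltnS; apply: (leq_trans (size_sum _ _ _)).
    by apply/bigmax_leqP=> i _; rewrite size_polyXn ltn_exp2l.
  have P0 : P != 0 by rewrite -size_poly_gt0 sP.
  apply/existsP; apply: contraT => /existsPn tr0.
  have : (size (enum K) < size P)%N.
    apply: max_poly_roots; rewrite ?enum_uniq //; apply/allP=> x _.
    have /negPn/eqP trx := tr0 x; rewrite /root horner_sum.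
    by rewrite (eq_bigr (fun i : 'I_n => x ^+ (#|F| ^ i))) => [|i _]; rewrite ?hornerXn // -field_traceE trx rmorph0.
  by rewrite -cardE cardK sP ltnS leq_exp2l // -[X in (X <= _)%N](prednK n_gt0) ltnn.
by exists (iota (t / field_trace x) * x); rewrite field_traceZ divfK.
Qed.

Lemma field_traceXp p x : p \in [pchar F] -> field_trace (x ^+ p) = field_trace x ^+ p.
Proof.
move=> pF; have pK : p \in [pchar K] by rewrite (fmorph_pchar iota).
apply: (fmorph_inj iota); rewrite rmorphXn /= !field_traceE.
rewrite -[in RHS](expn1 p) sum_exp_pchar // expn1.
by apply: eq_bigr => i _; rewrite -!exprM mulnC.
Qed.

(** The [n] Frobenius iterates of [x] run through its orbit [n %/ order frob x] times. *)
Lemma field_trace_orbit (f h : {poly F}) x : orbit_poly F x = h^K ->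
  field_trace f^K.[x] = root_sum f h *+ (n %/ order frob x).
Proof.
move=> hE; apply: (fmorph_inj iota); rewrite field_traceE rmorphMn /= -map_root_sum -hE.
pose v i := f^K.[iter i frob x].
have sum_period k : \sum_(i < k * order frob x) v i = (\sum_(i < order frob x) v i) *+ k.
  elim: k => [|k IHk]; first by rewrite big_ord0.
  rewrite mulSn big_split_ord /= mulrS; congr (_ + _); rewrite -IHk.
  by apply: eq_bigr => i _; rewrite /v addnC iterD iter_order //; apply: frob_inj iota.
have -> : root_sum f^K (\prod_(z <- orbit frob x) ('X - z%:P)) = \sum_(i < order frob x) v i.
  rewrite root_sum_prod /orbit (big_nth x) size_traject big_mkord; apply: eq_bigr => i _.
  by rewrite nth_traject.
rewrite -sum_period divnK ?(order_frob_dvd iota) //; apply: eq_bigr => i _.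
rewrite -iter_frob /v; elim: (nat_of_ord i) => //= j ->.
by rewrite horner_frob.
Qed.

(** Since [r] divides [n], the class of X in the field [F[X] / P] is fixed by the power [#|F|^n];
    hence [P] divides [X^(#|F|^n) - X], which splits over [K]. *)
Lemma irred_has_root r P : P \in irreds F r -> (r %| n)%N -> exists x, root P^K x.
Proof.
move=> /mem_irreds[Pm sP r0 iP] /dvdnP[k nE].
pose hI : monic_irreducible_poly P := (iP, Pm).
have PXn : P %| 'X^(#|F| ^ n) - 'X.
  pose a : {poly %/ P with hI} := in_qpoly P 'X.
  have : a ^+ (#|F| ^ n) = a.
    rewrite nE mulnC expnM -[r]/(r.+1.-1) -sP -(card_monic_qpoly _ Pm) ?sP //.
    elim: k {nE} => [|k IHk]; first by rewrite expn0 expr1.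
    by rewrite expnS exprM -[#|_|]/(#|{poly %/ P with hI}|) expf_card.
  rewrite /a -[_ ^+ _]/((in_qpoly P 'X : {poly %/ P}) ^+ (#|F| ^ n)) -rmorphXn /=.
  move=> /(congr1 (fun u : {poly %/ P} => u : {poly F})) /= E.
  apply/dvdpP; exists (Pdiv.Ring.rdivp ('X^(#|F| ^ n) - 'X) P).
  rewrite [LHS](Pdiv.RingMonic.rdivp_eq Pm) Pdiv.RingMonic.rmodpB //.
  by rewrite -[P in X in _ + (X - _)](mk_monicE hI) -[P in X in _ + (_ - X)](mk_monicE hI) E subrr addr0.
have : P^K %| \prod_(x <- enum K) ('X - x%:P).
  move: PXn; rewrite big_enum -finField_genPoly cardK -(dvdp_map iota).
  by rewrite rmorphB /= map_polyXn map_polyX.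
move=> /dvdp_prod_XsubC[m PE].
case Em: (mask m (enum K)) PE => [|x s] PE.
  by move: PE; rewrite big_nil => /eqp_size; rewrite size_poly1 size_map_poly sP => -[r00]; rewrite r00 in r0.
by exists x; rewrite (eqp_root PE) big_cons rootM root_XsubC eqxx.
Qed.

Lemma card_roots_irred r P : P \in irreds F r -> (r %| n)%N ->
  #|[pred x | root P^K x]| = r.
Proof.
move=> Pr rn; have [x Px] := irred_has_root Pr rn.
have [PE ->] := orbit_poly_unique Pr Px; rewrite -size_orbit -(card_uniqP (orbit_uniq _ _)).
by apply: eq_card => y; rewrite inE PE root_prod_XsubC.
Qed.

Variables (psi : F -> algC) (f : {poly F}).
Hypothesis psiC : add_char psi.

(** The elements of [K] are sorted by minimal polynomial: an irreducible [P] of degree [r] dividing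
    [n] has [r] roots in [K], at each of which the trace of [f] is [n / r] times [root_sum f P]. *)
Lemma Lpower_sum_extension :
  Lpower_sum psi f n = \sum_(x : K) psi (field_trace f^K.[x]).
Proof.
transitivity (\sum_(r < n.+1) \sum_(P <- irreds F r | (r %| n)%N)
    \sum_(x : K | root P^K x) psi (field_trace f^K.[x])).
  apply: eq_bigr => r _; rewrite big_seq_cond [RHS]big_seq_cond.
  apply: eq_bigr => P /andP[Pr rn].
  rewrite (eq_bigr (fun=> char_poly_sum psi f P ^+ (n %/ r))) => [|x Px]; last first.
    have [PE rE] := orbit_poly_unique Pr Px.
    by rewrite (field_trace_orbit _ (esym PE)) (add_charMn psiC) rE.
  by rewrite sumr_const (card_roots_irred Pr rn).
under eq_bigr do under eq_bigr do rewrite big_mkcond.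
under eq_bigr do rewrite exchange_big.
rewrite exchange_big /=; apply: eq_bigr => x _.
have [h hirr hE] := orbit_poly_irred iota x; have sn := order_frob_dvd iota cardK x.
have sltn : (order frob x < n.+1)%N by rewrite ltnS dvdn_leq.
have rh : root h^K x by rewrite -hE root_prod_XsubC in_orbit.
rewrite (bigD1 (Ordinal sltn)) //= [X in _ + X]big1 ?addr0 => [|r rs]; last first.
  rewrite big1_seq // => P /andP[_ Pr]; case: ifP => // Px.
  have [_ rE] := orbit_poly_unique Pr Px.
  by case/eqP: rs; apply: val_inj.
rewrite sn (bigD1_seq h) ?filter_uniq ?uniq_monics //= rh big1_seq ?addr0 // => P /andP[Ph Pr].
case: ifP => // Px; have [PE _] := orbit_poly_unique Pr Px.
by case/eqP: Ph; apply: (map_poly_inj iota); rewrite PE.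
Qed.

End ExtensionSum.

(** * Character sums over a field of square order *)

Section LargeFieldBound.

Variables (K : finFieldType) (p b d : nat) (f : {poly K}) (psi : K -> algC).
Hypotheses (pK : p \in [pchar K]) (b_gt0 : (0 < b)%N) (d_gt1 : (1 < d)%N).
Hypotheses (sf : size f = d.+1) (pd : ~~ (p %| d)%N).
Let r := (p ^ b.+1)%N.
Hypothesis cardK : #|K| = (r ^ 2)%N.
Hypotheses (psiC : add_char psi) (psiN1 : exists t, psi t != 1).
Hypothesis psiF : forall t, psi (t ^+ p) = psi t.

(* Sorting the pairs (x, y) by z = f(x) + y - y^p turns the sum into one over the curves y^p = y + f(x) - z. *)
Lemma large_field_bound : `|\sum_x psi f.[x]| <= (2 * p * d * r)%:R.
Proof.
pose Q := #|K|; have Q0 : (0 < Q)%N by rewrite /Q cardK expn_gt0 expn_gt0 prime_gt0 ?(pcharf_prime pK).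
pose N z := #|[set w : K * K | f.[w.1] + w.2 - w.2 ^+ p == z]|.
pose B := (Q + 2 * p * d * r)%N.
have NB z : (N z <= B)%N.
  have sfz : size (f - z%:P) = d.+1.
    rewrite size_polyDl // size_polyN sf (leq_ltn_trans (size_polyC_leq1 _)) //.
    by rewrite ltnS ltnW.
  rewrite /B /Q cardK; apply: leq_trans (artin_schreier_bound pK b_gt0 d_gt1 sfz pd cardK).
  apply: subset_leq_card; apply/subsetP => w; rewrite !inE => /eqP <-.
  by rewrite hornerD hornerN hornerC; apply/eqP; ring.
have sumN : \sum_z (N z)%:R = (Q ^ 2)%:R :> algC.
  rewrite -natr_sum; congr _%:R; rewrite -mulnn -card_prod -sum1_card.
  rewrite (partition_big (fun w : K * K => f.[w.1] + w.2 - w.2 ^+ p) xpredT) //=.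
  by apply: eq_bigr => z _; rewrite /N -sum1_card; apply: eq_bigl => w; rewrite inE.
(* For each [x] the [Q] choices of [y] give the same term, since the contributions of [y] and [y^p]
   cancel. *)
have E : Q%:R * \sum_x psi f.[x] = \sum_z psi z * (N z)%:R.
  transitivity (\sum_(w : K * K) psi (f.[w.1] + w.2 - w.2 ^+ p)).
    rewrite -(pair_bigA _ (fun x y => psi (f.[x] + y - y ^+ p))) /= mulr_sumr.
    apply: eq_bigr => x _; rewrite (eq_bigr (fun=> psi f.[x])) => [|y _].
      by rewrite sumr_const mulr_natl.
    rewrite !psiC.2 (add_charN psiC) psiF -mulrA -normCK (add_char_norm psiC).
    by rewrite expr1n mulr1.
  rewrite (partition_big (fun w : K * K => f.[w.1] + w.2 - w.2 ^+ p) xpredT) //=.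
  apply: eq_bigr => z _; rewrite (eq_bigr (fun=> psi z)) => [|w /eqP-> //].
  by rewrite sumr_const mulr_natr /N cardsE.
(* As [psi] sums to 0, [N z] may be replaced by [N z - B]. The [B - N z] are nonnegative with sum
   [Q B - Q^2], so the upper bound on the [N z] alone controls the absolute value. *)
have E' : Q%:R * \sum_x psi f.[x] = - \sum_z psi z * (B - N z)%:R.
  have S0 : \sum_z psi z * B%:R = 0 by rewrite -mulr_suml (add_char_sum psiC psiN1) mul0r.
  rewrite E -[LHS]subr0 -[X in _ - X]S0 -sumrB -sumrN.
  by apply: eq_bigr => z _; rewrite natrB // -mulrBr -mulrN opprB.
rewrite -(ler_pM2l (_ : 0 < Q%:R)) ?ltr0n // -[Q%:R in X in X <= _]ger0_norm ?ler0n //.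
rewrite -normrM E' normrN; apply: le_trans (ler_norm_sum _ _ _) _.
rewrite (eq_bigr (fun z => B%:R - (N z)%:R)) => [|z _]; last first.
  by rewrite normrM (add_char_norm psiC) mul1r normr_nat natrB.
rewrite sumrB sumr_const -/Q sumN -[B%:R *+ Q]mulr_natl /B natrD mulrDr natrX expr2.
by rewrite addrAC subrr add0r.
Qed.

End LargeFieldBound.

(** * Weil's bound *)

Section Weil.

Variables (F : finFieldType) (p d : nat) (f : {poly F}) (psi : F -> algC).
Hypotheses (pF : p \in [pchar F]) (psiC : add_char psi) (psiN1 : exists t, psi t != 1).
Hypothesis psiF : forall t, psi (t ^+ p) = psi t.
Hypotheses (sf : size f = d.+1) (d_gt0 : (0 < d)%N) (pd : ~~ (p %| d)%N).

Lemma Lpower_sum1 : Lpower_sum psi f 1 = \sum_x psi f.[x].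
Proof.
have cardF : #|F| = (#|F| ^ 1)%N by rewrite expn1.
rewrite (Lpower_sum_extension (idfun : {rmorphism F -> F}) (ltn0Sn 0) cardF) //.
apply: eq_bigr => x _; congr psi; rewrite map_poly_id //.
have := field_traceE (idfun : {rmorphism F -> F}) cardF f.[x].
by rewrite big_ord1 expn0 expr1.
Qed.

(** The extension of degree [2 m] has order [r^2] with [r = #|F|^m = p^(e m)]; [2 <= m] makes the
    exponent [b = e m - 1] positive. *)
Lemma Lpower_sum_even_bound m : (2 <= m)%N -> (1 < d)%N ->
  `|Lpower_sum psi f (m * 2)| <= (2 * p * d)%:R * #|F|%:R ^+ m.
Proof.
move=> m2 d1; have n0 : (0 < m * 2)%N by lia.
have [K [iota cardK]] := finite_extension F n0.
have pK : p \in [pchar K] by rewrite (fmorph_pchar iota).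
pose e := logn p #|F|; have cardF : #|F| = (p ^ e)%N := card_pchar pF.
have e0 : (0 < e)%N.
  by have := finNzRing_gt1 F; rewrite cardF; case: (e); rewrite ?expn0.
have em : (0 < (e * m).-1)%N.
  by rewrite -subn1 subn_gt0; apply: leq_trans m2 _; apply: leq_pmull.
have emE : (e * m).-1.+1 = (e * m)%N by rewrite prednK // muln_gt0 e0; lia.
have cardK2 : #|K| = ((p ^ (e * m).-1.+1) ^ 2)%N.
  by rewrite cardK [in LHS]cardF emE -!expnM mulnA.
rewrite (Lpower_sum_extension iota n0 cardK) //.
apply: le_trans (@large_field_bound K p (e * m).-1 d (map_poly iota f)
  (fun z => psi (field_trace iota (m * 2) z)) pK em d1 _ pd cardK2 _ _ _) _.
- by rewrite size_map_poly.
- split=> [|a b]; last by rewrite field_traceD // psiC.2.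
  suff -> : field_trace iota (m * 2) 0 = 0 by rewrite psiC.1.
  by have := field_traceZ iota cardK 0 0; rewrite rmorph0 !mul0r.
- have [t t1] := psiN1; have [x xt] := field_trace_surj iota n0 cardK t.
  by exists x; rewrite xt.
- by move=> t; rewrite field_traceXp.
- by rewrite emE expnM -cardF natrM natrX.
Qed.

(** Only power sums of even index are bounded, so [power_sum_growth] is applied to the squares of
    the inverse roots; each of the at most [d - 1] roots then has absolute value at most the square
    root of [#|F|]. *)
Theorem weil_bound : `|\sum_x psi f.[x]| <= d.-1%:R * sqrtC #|F|%:R.
Proof.
have dF : d%:R != 0 :> F by rewrite -(dvdn_pcharf pF).
have [s ss sE] := Lpower_sum_roots psiC psiN1 sf d_gt0 dF.
have q0 : 0 < #|F|%:R :> algC by rewrite ltr0n (ltnW (finNzRing_gt1 F)).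
have roots_le a : a \in s -> `|a| <= sqrtC #|F|%:R.
  move=> sa; have d1 : (1 < d)%N.
    by have := ss; case: (s) sa => // z t _ /=; lia.
  have : `|a ^+ 2| <= #|F|%:R.
    apply: (@power_sum_growth [seq z ^+ 2 | z <- s] (2 * p * d)%:R _ 2) => //; last exact: map_f.
    move=> m m2; rewrite big_map; apply: le_trans (Lpower_sum_even_bound m2 d1).
    rewrite sE ?muln_gt0 ?(ltnW m2) // normrN le_eqVlt; apply/orP; left; apply/eqP.
    by congr `|_|; apply: eq_bigr => z _; rewrite mulnC exprM.
  rewrite normrX => a2; rewrite -(ler_pXn2r (ltn0Sn 1)) ?nnegrE ?sqrtC_ge0 ?(ltW q0) //.
  by rewrite sqrtCK.
rewrite -Lpower_sum1 sE // normrN; apply: le_trans (ler_norm_sum _ _ _) _.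
under eq_bigr do rewrite expr1.
apply: (@le_trans _ _ (\sum_(a <- s) sqrtC #|F|%:R)).
  by rewrite big_seq [X in _ <= X]big_seq; apply: ler_sum => a /roots_le.
rewrite big_const_seq iter_addr_0 count_predT -[_ *+ size s]mulr_natl ler_wpM2r ?ler_nat //.
by rewrite sqrtC_ge0 ltW.
Qed.

End Weil.

(** The character [z^Tr(x)], with [z] a primitive [p]-th root of unity and [Tr] the trace to the
    prime field. It is nontrivial as the trace is surjective, and invariant under [p]-th powers as
    [a^p = a] in ['F_p]. *)
Lemma exists_trace_char (F : finFieldType) p : p \in [pchar F] ->
  exists psi : F -> algC, [/\ add_char psi, exists t, psi t != 1
    & forall t, psi (t ^+ p) = psi t].
Proof.
move=> pF; have p_pr := pcharf_prime pF.
pose io : {rmorphism 'F_p -> F} := (in_alg (pPrimeCharType pF) : {rmorphism 'F_p -> pPrimeCharType pF}).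
have cardF : #|F| = (#|'F_p| ^ logn p #|F|)%N by rewrite card_Fp // -card_pchar.
have n0 : (0 < logn p #|F|)%N.
  by have := finNzRing_gt1 F; rewrite [X in (1 < X)%N](card_pchar pF); case: (logn _ _).
have [z z_prim] := C_prim_root_exists (prime_gt0 p_pr).
pose tr x := field_trace io (logn p #|F|) x.
have zD (a b : 'F_p) : z ^+ (a + b)%R = z ^+ a * z ^+ b.
  by rewrite -exprD /= [X in (_ %% X)%N]Fp_cast // (prim_expr_mod z_prim).
exists (fun x => z ^+ tr x); split.
- split=> [|x y]; last by rewrite /tr field_traceD.
  suff -> : tr 0 = 0 by rewrite expr0.
  by have := field_traceZ io cardF 0 0; rewrite rmorph0 !mul0r.
- have [x xt] := field_trace_surj io n0 cardF 1.
  exists x; rewrite /tr xt -(prim_order_dvd z_prim) /= .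
  by rewrite dvdn1 gtn_eqF ?prime_gt1.
- move=> x; rewrite /tr field_traceXp ?pchar_Fp //.
  by have := expf_card (field_trace io (logn p #|F|) x); rewrite card_Fp // => ->.
Qed.

(** * The spectrum of the graph *)

Section CayleyEigenvalues.

Variables (F : finFieldType) (k : nat) (psi : F -> algC) (conn : pred {ffun 'I_k -> F}).
Hypotheses (psiC : add_char psi) (psiN1 : exists t, psi t != 1).
Local Notation V := {ffun 'I_k -> F}.

Definition vertex_char (w a : V) := psi (\sum_i w i * a i).

Lemma vertex_charD w : {morph vertex_char w : a b / a + b >-> a * b}.
Proof.
move=> a b; rewrite /vertex_char -psiC.2 -big_split; congr psi.
by apply: eq_bigr => i _; rewrite ffunE mulrDr.
Qed.

Lemma sum_vertex_char (c : V) : c != 0 -> \sum_w vertex_char w c = 0.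
Proof.
move=> c0; have [i ci] : exists i, c i != 0.
  apply/existsP; apply: contraNT c0 => /existsPn c0; apply/eqP/ffunP => i.
  by rewrite ffunE; apply/eqP/negPn/c0.
have [t t1] := psiN1; pose e : V := [ffun j => if j == i then t / c i else 0].
have eE : vertex_char e c = psi t.
  rewrite /vertex_char (bigD1 i) //= ffunE eqxx divfK // big1 ?addr0 // => j ji.
  by rewrite ffunE (negPf ji) mul0r.
have E : \sum_w vertex_char w c = psi t * \sum_w vertex_char w c.
  rewrite mulr_sumr (reindex_inj (addrI e)); apply: eq_bigr => w _.
  rewrite -eE /vertex_char -psiC.2 -big_split; congr psi.
  by apply: eq_bigr => j _; rewrite ffunE mulrDl.
apply/eqP; move/eqP: E; rewrite -subr_eq0 -{1}[\sum_w _]mul1r -mulrBl mulf_eq0 subr_eq0 eq_sym.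
by rewrite (negPf t1).
Qed.

(** The adjacency operator is a convolution: it multiplies the Fourier transform [hat] of an
    eigenvector at [w] by the character sum over [conn]. Any [w] with [hat w != 0] will do, and one
    exists by Fourier inversion. *)
Lemma cayley_eigenvalue (lam : algC) :
  eigenvalue (\matrix_(i, j < #|{: V}|) ((conn (enum_val j - enum_val i))%:R : algC)) lam ->
  exists w, lam = \sum_(s | conn s) vertex_char w s.
Proof.
move=> /eigenvalueP[v vA v0].
pose u (a : V) := v 0 (enum_rank a).
have uA b : \sum_a u a * (conn (b - a))%:R = lam * u b.
  have /rowP/(_ (enum_rank b)) := vA; rewrite !mxE => <-.
  rewrite (reindex _ (onW_bij _ (@enum_rank_bij V))) /=; apply: eq_bigr => a _.
  by rewrite mxE !enum_rankK.
pose hat w := \sum_a u a * vertex_char w a.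
have [w hw] : exists w, hat w != 0.
  apply/existsP; apply: contraNT v0 => /existsPn hat0; apply/eqP/rowP => j.
  rewrite mxE -[j]enum_valK -/(u _); set b := enum_val j.
  have : \sum_w hat w * vertex_char w (- b) = 0.
    by rewrite big1 // => w _; rewrite (eqP (negbNE (hat0 w))) mul0r.
  under eq_bigr do rewrite mulr_suml; rewrite exchange_big /=.
  rewrite (bigD1 b) //= [X in _ + X]big1 => [|a ab]; last first.
    under eq_bigr do rewrite -mulrA -vertex_charD.
    by rewrite -mulr_sumr sum_vertex_char ?mulr0 // subr_eq0.
  under eq_bigr do rewrite -mulrA -vertex_charD subrr.
  rewrite addr0 -mulr_sumr => /eqP; rewrite mulf_eq0 => /orP[/eqP //|].
  rewrite (eq_bigr (fun=> 1)) => [|w _]; last first.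
    by rewrite /vertex_char big1 ?psiC.1 // => i _; rewrite ffunE mulr0.
  by rewrite sumr_const pnatr_eq0 => /eqP/card0_eq/(_ 0).
exists w; apply: (mulIf hw); rewrite /hat mulr_sumr.
transitivity (\sum_(b : V) \sum_(a : V) u a * (conn (b - a))%:R * vertex_char w b).
  by apply: eq_bigr => b _; rewrite mulrA -uA mulr_suml.
rewrite exchange_big mulrC mulr_suml; apply: eq_bigr => a _ /=.
rewrite (reindex_inj (addrI a)) /= mulr_sumr [RHS]big_mkcond /=.
apply: eq_bigr => s _; rewrite addrAC subrr add0r vertex_charD mulrA.
by case: (conn s); rewrite ?mulr1 ?mulr0 ?mul0r // mulrA.
Qed.

End CayleyEigenvalues.

(** * The character sums of the graph and their bound *)

Section SpectralBound.

Variables (F : finFieldType) (k p : nat) (f g : 'I_k -> {poly F}).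
Hypotheses (k_ge3 : (3 <= k)%N) (pF : p \in [pchar F]) (fgP : S_params f g).
Hypothesis g0 : forall i : 'I_k, (2 <= i)%N -> (g i).[0] = 0.
Hypotheses (df_gt0 : (1 <= dmax f)%N) (dg_gt0 : (1 <= dmax g)%N) (dg_lt : (dmax g < p)%N).
Local Notation V := {ffun 'I_k -> F}.

Let i0 : 'I_k := Ordinal (leq_trans (ltn0Sn 2) k_ge3).
Let i1 : 'I_k := Ordinal (leq_trans (ltnSn 1) (ltnW k_ge3)).

Let coord0 (a : V) : Defs.coord a 0 = a i0.
Proof. by rewrite /Defs.coord; case: insubP => [i _ i0E|]; [rewrite (_ : i = i0) //; apply: val_inj | rewrite (leq_trans _ k_ge3)]. Qed.

Let coord1 (a : V) : Defs.coord a 1 = a i1.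
Proof. by rewrite /Defs.coord; case: insubP => [i _ i1E|]; [rewrite (_ : i = i1) //; apply: val_inj | rewrite (leq_trans _ k_ge3)]. Qed.

Let conn (s : V) := S_adj f g 0 s.

Lemma S_adj_translate (a b : V) : S_adj f g a b = S_adj f g 0 (b - a).
Proof.
rewrite /S_adj !coord0 !coord1 !ffunE !subr0 eq_sym [in RHS]eq_sym subr_eq0.
by congr (_ && _); apply: eq_forallb => i; rewrite !ffunE subr0.
Qed.

Let size_dmax (h : 'I_k -> {poly F}) (i : 'I_k) : (2 <= i)%N -> (size (h i) <= (dmax h).+1)%N.
Proof.
move=> i2; have := leq_bigmax_cond (P := fun i : 'I_k => (2 <= i)%N) (F := fun i => (size (h i)).-1) i i2.
by rewrite -/(dmax h); case: (size _).
Qed.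

(** The neighbours of 0, parametrized by the first coordinate [x != 0] and the quotient [y] of the
    second by the first. *)
Let pt (x y : F) : V := [ffun i : 'I_k =>
  if i == i0 then x else if i == i1 then x * y else (g i).[x] * (f i).[y]].

Let ord_ge2 (i : 'I_k) : (2 <= i)%N = (i != i0) && (i != i1).
Proof. by rewrite -!val_eqE /=; case: (nat_of_ord i) => [|[|]]. Qed.

Variables (psi : F -> algC) (w : V).
Hypotheses (psiC : add_char psi) (psiN1 : exists t, psi t != 1).
Hypothesis psiF : forall t, psi (t ^+ p) = psi t.

Let G (y : F) : {poly F} :=
  (w i0 + w i1 * y) *: 'X + \sum_(i : 'I_k | (2 <= i)%N) (w i * (f i).[y]) *: g i.

Let vertex_char_pt x y : vertex_char psi w (pt x y) = psi (G y).[x].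
Proof.
congr psi; rewrite (bigD1 i0) //= (bigD1 i1) //= /G hornerD hornerZ hornerX horner_sum addrA.
congr (_ + _); first by rewrite !ffunE eqxx /= mulrDl mulrAC -mulrA.
rewrite (eq_bigl (fun i : 'I_k => (2 <= i)%N)) => [|i]; last by rewrite ord_ge2.
apply: eq_bigr => i; rewrite ord_ge2 => /andP[ni0 ni1].
by rewrite ffunE (negPf ni0) (negPf ni1) hornerZ -mulrA [(f i).[y] * _]mulrC.
Qed.

Let eigenvalueE : \sum_(s | conn s) vertex_char psi w s =
  \sum_y \sum_(x | x != 0) psi (G y).[x].
Proof.
rewrite exchange_big /= pair_big_dep /=.
rewrite (reindex_onto (fun z : F * F => pt z.1 z.2) (fun s : V => (s i0, s i1 / s i0))) /=.
  apply: eq_big => [[x y]|[x y] _] /=; last by rewrite vertex_char_pt.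
  rewrite andbT; apply/andP/idP => [[]|x0].
    by rewrite /conn /S_adj coord0 coord0 !ffunE eqxx eq_sym => /andP[].
  split; last by rewrite !ffunE !eqxx /= mulrC mulKf.
  rewrite /conn /S_adj !coord0 !coord1 !ffunE !eqxx /= !subr0 eq_sym x0 /= [x * y]mulrC mulfK //.
  apply/forallP => i; apply/implyP; rewrite ord_ge2 => /andP[ni0 ni1].
  by rewrite !ffunE (negPf ni0) (negPf ni1) subr0.
move=> s; rewrite /conn /S_adj !coord0 !coord1 !ffunE !subr0 eq_sym => /andP[s0 /forallP sE].
apply/ffunP => i; rewrite ffunE; case: eqP => [->//|/eqP ni0]; case: eqP => [->|/eqP ni1].
  by rewrite mulrC divfK.
by have := sE i; rewrite ord_ge2 ni0 ni1 ffunE subr0 => /eqP.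
Qed.

Let G0 y : (G y).[0] = 0.
Proof.
rewrite /G hornerD hornerZ hornerX mulr0 add0r horner_sum big1 // => i i2.
by rewrite hornerZ g0 // mulr0.
Qed.

Let G_odd y x : (G y).[- x] = - (G y).[x].
Proof.
rewrite /G !hornerD !hornerZ !hornerX !horner_sum opprD mulrN; congr (_ + _).
rewrite -sumrN; apply: eq_bigr => i i2; have [_ _ godd] := fgP i2.
have := congr1 (horner^~ x) godd; rewrite horner_comp hornerN hornerX hornerN => gx.
by rewrite !hornerZ gx mulrN.
Qed.

Let size_G y : (size (G y) <= (dmax g).+1)%N.
Proof.
rewrite (leq_trans (size_polyD _ _)) // geq_max; apply/andP; split.
  by rewrite (leq_trans (size_scale_leq _ _)) // size_polyX.
apply: (leq_trans (size_sum _ _ _)); apply/bigmax_leqP => i i2.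
exact: leq_trans (size_scale_leq _ _) (size_dmax g i2).
Qed.

Let sumG y := \sum_(x | x != 0) psi (G y).[x].

Let sumG_le_card y : `|sumG y| <= #|F|%:R.
Proof.
apply: le_trans (ler_norm_sum _ _ _) _.
rewrite (eq_bigr (fun=> 1)) => [|x _]; last exact: add_char_norm psiC _.
by rewrite sumr_const ler_nat max_card.
Qed.

(** Having no constant term, a nonzero [G y] has degree [n] from 1 to [dmax g < p]. Leaving out
    [x = 0] costs 1, at most [sqrtC #|F|], which turns the factor [n - 1] of Weil's bound into
    [n]. *)
Let sumG_weil y : G y != 0 -> `|sumG y| <= (dmax g)%:R * sqrtC #|F|%:R.
Proof.
move=> Gy0; pose n := (size (G y)).-1.
have s0 : (0 < size (G y))%N by rewrite size_poly_gt0.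
have sG : size (G y) = n.+1 by rewrite prednK.
have n0 : (0 < n)%N.
  rewrite lt0n; apply: contra_neq Gy0 => n0; have /eq_leq/size1_polyC GE : size (G y) = 1%N by rewrite sG n0.
  by rewrite GE -horner_coef0 G0.
have ndg : (n <= dmax g)%N by rewrite -ltnS -sG size_G.
have pn : ~~ (p %| n)%N by rewrite gtnNdvd // (leq_ltn_trans ndg).
have q1 : 1 <= sqrtC #|F|%:R :> algC.
  by rewrite -[X in X <= _]sqrtC1 ler_sqrtC ?nnegrE ?ler01 ?ler0n // ler1n (ltnW (finNzRing_gt1 F)).
have E : sumG y = \sum_x psi (G y).[x] - 1.
  by rewrite (bigD1 0) //= G0 psiC.1 [1 + _]addrC addrK.
rewrite E; apply: le_trans (ler_normB _ _) _; rewrite normr1.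
apply: le_trans (lerD (weil_bound pF psiC psiN1 psiF sG n0 pn) (lexx _)) _.
apply: (@le_trans _ _ (n.-1%:R * sqrtC #|F|%:R + sqrtC #|F|%:R)); first by rewrite lerD2l.
have -> : n.-1%:R * sqrtC #|F|%:R + sqrtC #|F|%:R = n%:R * sqrtC #|F|%:R :> algC.
  by rewrite -[in RHS](prednK n0) -natr1 mulrDl mul1r.
by rewrite ler_wpM2r ?sqrtC_ge0 ?ler0n // ler_nat.
Qed.

(* If more than dmax f of the polynomials G y vanish, then so does every C j, hence every G y. *)
Let C (j : nat) : {poly F} := (w i0)%:P *+ (j == 1)%N + w i1 *: 'X *+ (j == 1)%N +
  \sum_(i : 'I_k | (2 <= i)%N) (w i * (g i)`_j) *: f i.

Let C_coef j y : (C j).[y] = (G y)`_j.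
Proof.
rewrite /C /G coefD coefZ coefX !coef_sum !hornerD !hornerMn hornerC hornerZ hornerX horner_sum.
congr (_ + _); last first.
  by apply: eq_bigr => i _; rewrite hornerZ coefZ mulrAC.
by rewrite -mulrnDl mulr_natr.
Qed.

Let size_C j : (size (C j) <= (dmax f).+1)%N.
Proof.
rewrite (leq_trans (size_polyD _ _)) // geq_max; apply/andP; split; last first.
  apply: (leq_trans (size_sum _ _ _)); apply/bigmax_leqP => i i2.
  exact: leq_trans (size_scale_leq _ _) (size_dmax f i2).
case: (j == 1)%N; rewrite ?mulr0n ?addr0 ?size_poly0 // !mulr1n.
rewrite (leq_trans (size_polyD _ _)) // geq_max (leq_trans (size_polyC_leq1 _)) //=.
by rewrite (leq_trans (size_scale_leq _ _)) // size_polyX.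
Qed.

Lemma vertex_char_sum_bound : \sum_(s | conn s) vertex_char psi w s != (#|F| * (#|F| - 1))%:R ->
  \sum_(s | conn s) vertex_char psi w s <=
    (dmax f * #|F|)%:R + (dmax g)%:R * #|F|%:R * sqrtC #|F|%:R.
Proof.
rewrite eigenvalueE => lam_neq.
have [y0 Gy0] : exists y, G y != 0.
  apply/existsP; apply: contraNT lam_neq => /existsPn Gz.
  rewrite (eq_bigr (fun=> (#|F| - 1)%:R)) => [|y _].
    by rewrite sumr_const -[_ *+ _]mulr_natl -natrM.
  rewrite (eq_bigr (fun=> 1)) => [|x _]; last by rewrite (eqP (negbNE (Gz y))) horner0 psiC.1.
  by rewrite sumr_const cardC1 subn1.
have [j Gj] : exists j, (G y0)`_j != 0.
  by exists (size (G y0)).-1; rewrite -lead_coefE lead_coef_eq0.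
have Cj : C j != 0 by apply: contraNneq Gj => Cj; rewrite -C_coef Cj horner0.
have few_zeros : (#|[pred y | (G y == 0)%R]| <= dmax f)%N.
  rewrite cardE -ltnS; apply: leq_trans (size_C j).
  apply: max_poly_roots; rewrite ?enum_uniq //; apply/allP => y; rewrite mem_enum inE => /eqP Gy.
  by rewrite /root C_coef Gy coef0.
(* The order on [algC] is partial, so the sum must be real before it is compared with its absolute
   value; [x -> -x] conjugates the terms because [G y] is odd. *)
have lam_real : \sum_y sumG y \is Num.real.
  apply/CrealP; rewrite rmorph_sum /=; apply: eq_bigr => y _.
  rewrite rmorph_sum /= (reindex_inj oppr_inj) /=.
  apply: eq_big => [x|x _]; first by rewrite oppr_eq0.
  by rewrite G_odd (add_charN psiC) conjCK.
apply: le_trans (real_ler_norm lam_real) _; apply: le_trans (ler_norm_sum _ _ _) _.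
rewrite (bigID [pred y | G y == 0]) /= mulrAC; apply: lerD.
  apply: (@le_trans _ _ (\sum_(y | G y == 0) #|F|%:R)).
    by apply: ler_sum => y _; apply: sumG_le_card.
  by rewrite sumr_const -[_ *+ _]mulr_natl -natrM ler_nat leq_mul2r few_zeros orbT.
apply: (@le_trans _ _ (\sum_(y | G y != 0) (dmax g)%:R * sqrtC #|F|%:R)).
  by apply: ler_sum => y; apply: sumG_weil.
rewrite sumr_const -[_ *+ #|_|]mulr_natr ler_wpM2l ?mulr_ge0 ?sqrtC_ge0 ?ler0n //.
by rewrite ler_nat max_card.
Qed.

End SpectralBound.

Theorem mainTheorem7 (k : nat) (hk : (3 <= k)%N)
    (F : nat -> finFieldType) (p : nat -> nat)
    (hp : forall m, p m \in [pchar (F m)])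
    (hinc : forall m, (#|F m| < #|F m.+1|)%N)
    (f g : forall m, 'I_k -> {poly F m})
    (hpar : forall m, S_params (f m) (g m))
    (hg0 : forall m (i : 'I_k), (2 <= i)%N -> (g m i).[0] = 0)
    (hdf : forall m, (1 <= dmax (f m))%N)
    (hdg1 : forall m, (1 <= dmax (g m))%N)
    (hdgp : forall m, (dmax (g m) < p m)%N) :
  forall m (lam : algC),
    eigenvalue (S_adjmx (f m) (g m)) lam ->
    lam != (#|F m| * (#|F m| - 1))%:R ->
    lam <= (dmax (f m) * #|F m|)%:R
           + (dmax (g m))%:R * (#|F m|)%:R * sqrtC (#|F m|)%:R.
Proof.
move=> m lam lam_eig lam_neq.
have [psi [psiC psiN1 psiF]] := exists_trace_char (hp m).
have [w lamE] : exists w, lam = \sum_(s | S_adj (f m) (g m) 0 s) vertex_char psi w s.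
  (* Translation invariance makes the graph a Cayley graph whose connection set is the set of
     neighbours of 0. *)
  apply: (cayley_eigenvalue psiC psiN1); move: lam_eig; congr (eigenvalue _ lam).
  by apply/matrixP=> i j; rewrite !mxE (S_adj_translate _ _ hk).
rewrite lamE; apply: (vertex_char_sum_bound hk (hp m)); rewrite -?lamE //.
exact: hg0.
Qed.
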